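(* Let $f\colon \mathbb{Z}\times\mathbb{R}^n\to\mathbb{R}^n$ be continuous. The system $x(k+1)=f(k,x(k))$, $k\in\mathbb{Z}$, is uniformly globally asymptotically incrementally stable if and only if there exist a smooth function $V\colon \mathbb{Z}\times\mathbb{R}^n\times\mathbb{R}^n\to\mathbb{R}_{\geq 0}$, functions $\alpha_1,\alpha_2\in\mathcal{K}_\infty$, and a positive definite function $\alpha_3\colon\mathbb{R}_{\geq 0}\to\mathbb{R}_{\geq 0}$ such that $$\alpha_1(|x_1-x_2|)\leq V(k,x_1,x_2)\leq \alpha_2(|x_1-x_2|),$$ $$V\big(k+1,f(k,x_1),f(k,x_2)\big)-V(k,x_1,x_2)\leq -\alpha_3(|x_1-x_2|)$$ hold for all $x_1,x_2\in\mathbb{R}^n$ and $k\in\mathbb{Z}$.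
   Context: $|\cdot|$ is the Euclidean norm. For $k_0\in\mathbb{Z}$ and $\xi\in\mathbb{R}^n$, $\phi(\cdot;k_0,\xi)\colon\mathbb{Z}_{\geq k_0}\to\mathbb{R}^n$ denotes the solution: $\phi(k_0;k_0,\xi)=\xi$ and $\phi(k+1;k_0,\xi)=f(k,\phi(k;k_0,\xi))$ for all $k\geq k_0$. Comparison functions: $\alpha\colon\mathbb{R}_{\geq0}\to\mathbb{R}_{\geq0}$ is of class $\mathcal{K}$ if it is continuous, zero at zero and strictly increasing; it is of class $\mathcal{K}_\infty$ if in addition it is unbounded. $\sigma\colon\mathbb{R}_{\geq0}\to\mathbb{R}_{\geq0}$ is of class $\mathcal{L}$ if it is continuous, strictly decreasing and $\lim_{t\to\infty}\sigma(t)=0$. $\beta\colon\mathbb{R}_{\geq0}\times\mathbb{R}_{\geq0}\to\mathbb{R}_{\geq0}$ is of class $\mathcal{KL}$ if it is of class $\mathcal{K}$ in its first argument and of class $\mathcal{L}$ in its second argument (with the convention $\beta(0,t)=0$ for all $t\geq 0$). A positive definite function $\alpha_3\colon\mathbb{R}_{\geq0}\to\mathbb{R}_{\geq0}$ is a continuous function with $\alpha_3(0)=0$ and $\alpha_3(s)>0$ for $s>0$. Smooth means infinitely often differentiable (in the $\mathbb{R}^n$-variables, for each fixed $k\in\mathbb{Z}$). The system is uniformly globally asymptotically incrementally stable if there exists $\beta\in\mathcal{KL}$ such that $|\phi(k;k_0,\xi_1)-\phi(k;k_0,\xi_2)|\leq\beta(|\xi_1-\xi_2|,k-k_0)$ for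 all $\xi_1,\xi_2\in\mathbb{R}^n$ and all $k,k_0\in\mathbb{Z}$ with $k\geq k_0$. *)

(* Defs.v *)
From HB Require Import structures.
From mathcomp Require Import all_boot all_order all_algebra.
From mathcomp Require Import all_classical all_reals all_analysis.

Set Implicit Arguments.
Unset Strict Implicit.
Unset Printing Implicit Defensive.

Import Order.TTheory GRing.Theory Num.Theory.
Import numFieldNormedType.Exports.

Local Open Scope classical_set_scope.
Local Open Scope ring_scope.

(* The library norm on row vectors is the sup norm; it induces the same
   topology and the same notion of differentiability as this one. *)
Definition enorm (R : realType) (n : nat) (x : 'rV[R]_n) : R :=
  Num.sqrt (\sum_(i < n) x 0 i ^+ 2).

(* A comparison function on [0, +oo[ is represented by a function R -> R of
   which only the restriction to [0, +oo[ is constrained. Nonnegativity of its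
   values there follows from the clauses of each definition below. *)
Definition class_K (R : realType) (a : R -> R) : Prop :=
  [/\ {within `[0, +oo[%classic, continuous a},
      a 0 = 0 &
      {in `[0, +oo[ &, {homo a : s t / s < t}}].

Definition class_Kinf (R : realType) (a : R -> R) : Prop :=
  class_K a /\ (forall M : R, exists2 s : R, 0 <= s & M < a s).

Definition class_L (R : realType) (a : R -> R) : Prop :=
  [/\ {within `[0, +oo[%classic, continuous a},
      {in `[0, +oo[ &, {homo a : s t /~ s < t}} &
      a t @[t --> +oo] --> (0 : R)].

(* At s = 0, the function b 0 is identically 0 on [0, +oo[ by the class K
   clause, hence is exempted from being strictly decreasing. *)
Definition class_KL (R : realType) (b : R -> R -> R) : Prop :=
  (forall t : R, 0 <= t -> class_K (b ^~ t)) /\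
  (forall s : R, 0 < s -> class_L (b s)).

Definition positive_definite (R : realType) (a : R -> R) : Prop :=
  [/\ {within `[0, +oo[%classic, continuous a},
      a 0 = 0 &
      forall s : R, 0 < s -> 0 < a s].

(* m-fold Frechet differentiability on the whole of E: since
   'D_v g x = 'd g x v, in finite dimension the derivative of g is m times
   differentiable iff all the functions 'D_v g are. *)
Fixpoint times_differentiable (R : realType) (E : normedModType R) (m : nat)
    (g : E -> R) : Prop :=
  if m is m'.+1 then
    (forall x : E, differentiable g x) /\
    (forall v : E, times_differentiable m' ('D_v g))
  else True.

Definition smooth (R : realType) (E : normedModType R) (g : E -> R) : Prop :=
  forall m : nat, times_differentiable m g.

Section System.
Variables (R : realType) (n : nat) (f : int -> 'rV[R]_n -> 'rV[R]_n).

Fixpoint phi_steps (k0 : int) (xi : 'rV[R]_n) (j : nat) : 'rV[R]_n :=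
  if j is j'.+1 then f (k0 + j'%:Z) (phi_steps k0 xi j') else xi.

(* Only meaningful for k0 <= k. *)
Definition phi (k k0 : int) (xi : 'rV[R]_n) : 'rV[R]_n :=
  phi_steps k0 xi `|k - k0|%N.

Lemma phi_init k0 xi : phi k0 k0 xi = xi.
Proof. by rewrite /phi subrr. Qed.

Lemma phi_rec k k0 xi : k0 <= k -> phi (k + 1) k0 xi = f k (phi k k0 xi).
Proof.
move=> le_k0k; rewrite /phi addrAC -(subrK k0 k) addrK.
have : 0 <= k - k0 by rewrite subr_ge0.
by case: (k - k0) => // j _; rewrite -PoszD addn1 /= addrC.
Qed.

Definition incrementally_stable : Prop :=
  exists b : R -> R -> R, class_KL b /\
    forall (xi1 xi2 : 'rV[R]_n) (k k0 : int), k0 <= k ->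
      enorm (phi k k0 xi1 - phi k k0 xi2) <= b (enorm (xi1 - xi2)) (k - k0)%:~R.

End System.

(* Main.v *)
Require Import Defs.
From HB Require Import structures.
From mathcomp Require Import all_boot all_order all_algebra.
From mathcomp Require Import all_classical all_reals all_analysis.
From mathcomp Require Import ring lra.

Set Implicit Arguments.
Unset Strict Implicit.
Unset Printing Implicit Defensive.

Import Order.TTheory GRing.Theory Num.Theory.
Import numFieldNormedType.Exports.

Local Open Scope classical_set_scope.
Local Open Scope ring_scope.

(* From stability to V: with d_j = |phi(k + j; k, x1) - phi(k + j; k, x2)|, the
   function V0 = sup_j (2 - 1/(j+1)) d_j satisfies d_0 <= V0 <= 2 beta(d_0, 0),
   has open strict sublevel and superlevel sets, and is multiplied by at most
   some l < 1 along the system, uniformly as long as a <= V0 <= B.  Call (p, q)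
   a gap if one step takes {V0(k, .) < q} into {V0(k + 1, .) <= p}, and choose
   smooth theta_k with values in [0, 1], equal to 0 on {V0(k, .) <= p} and to 1
   on {V0(k, .) >= q}: then theta never increases along the system, whatever its
   values between the two sets.  The required V is a sum of c_i theta_{i,k} over
   a countable family of gaps fine enough that at each step some theta_{i,k}
   drops from 1 to 0.  Coefficients c_i decaying fast enough make the series
   smooth, also on the diagonal; countably many k are handled by asking c_i to
   control only the first i of them.  Gaps with p >= i + 1 get c_i = 1, which
   makes V unbounded without spoiling local finiteness.

   From V to stability: along the system V decreases by a positive amount,
   uniformly on compact ranges of values, hence tends to 0 uniformly from bounded
   initial values.  The supremum of the values over all trajectories, with a
   penalty on initial values above v and a cutoff in time, is Lipschitz in v and
   in t, and gives the KL bound. *)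

(** * Closure properties of differentiability of order m *)

Lemma continuous_sum (R : realType) (T : topologicalType) (I : Type)
    (s : seq I) (h : I -> T -> R) :
  (forall i, continuous (h i)) -> continuous (fun x => \sum_(i <- s) h i x).
Proof.
move=> ch; elim: s => [|i s IHs].
  by under eq_fun do rewrite big_nil; move=> x; exact: cvg_cst.
under eq_fun do rewrite big_cons; move=> x.
by apply: cvgD; [exact: ch|exact: IHs].
Qed.

Section Calculus.
Variables (R : realType) (E : normedModType R).
Implicit Types (f g : E -> R) (m : nat).
Local Notation td := times_differentiable.

Lemma tdW m g : td m.+1 g -> td m g.
Proof.
elim: m g => [//|m IHm] g [dg tg]; split => // v.
exact: IHm (tg v).
Qed.

Lemma td_leq m1 m2 g : (m1 <= m2)%N -> td m2 g -> td m1 g.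
Proof.
move=> /subnK <-; elim: (_ - _)%N => [//|k IHk] tg.
exact/IHk/tdW.
Qed.

Lemma td_cst m (c : R) : td m (fun _ : E => c).
Proof.
elim: m c => [//|m IHm] c; split => [x|v].
  exact: differentiable_cst.
rewrite (_ : 'D_v _ = fun=> 0); first by apply: IHm.
by apply/funext => x; exact: derive_cst.
Qed.

Lemma tdD m f g : td m f -> td m g -> td m (fun x => f x + g x).
Proof.
elim: m f g => [//|m IHm] f g [df tf] [dg tg]; split => [x|v].
  exact: (@differentiableD _ _ _ f g).
rewrite (_ : 'D_v _ = fun x => 'D_v f x + 'D_v g x); first exact: IHm (tf v) (tg v).
by apply/funext => x; apply: (@deriveD _ _ _ f g); exact: diff_derivable.
Qed.

Lemma tdZ m (c : R) g : td m g -> td m (fun x => c * g x).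
Proof.
elim: m g => [//|m IHm] g [dg tg]; split => [x|v].
  exact: (@differentiableZ _ _ _ g c).
rewrite (_ : 'D_v _ = fun x => c * 'D_v g x); first exact: IHm (tg v).
by apply/funext => x; apply: (@deriveZ _ _ _ g c); exact: diff_derivable.
Qed.

Lemma td_sum m (I : Type) (s : seq I) (h : I -> E -> R) :
  (forall i, td m (h i)) -> td m (fun x => \sum_(i <- s) h i x).
Proof.
move=> th; elim: s => [|i s IHs].
  by under eq_fun do rewrite big_nil; exact: td_cst.
by under eq_fun do rewrite big_cons; exact: tdD.
Qed.

Lemma tdM m f g : td m f -> td m g -> td m (fun x => f x * g x).
Proof.
elim: m f g => [//|m IHm] f g tf tg.
have [df tdf] := tf; have [dg tdg] := tg; split => [x|v].
  exact: (@differentiableM _ _ f g).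
rewrite (_ : 'D_v _ = fun x => f x * 'D_v g x + g x * 'D_v f x); last first.
  by apply/funext => x; apply: (@deriveM _ _ f g); exact: diff_derivable.
by apply: tdD; apply: IHm => //; do ?[exact: tdW|exact: tdf|exact: tdg].
Qed.

Lemma tdV m g : (forall x, g x != 0) -> td m g -> td m (fun x => (g x)^-1).
Proof.
move=> g0; elim: m => [//|m IHm] tg.
have [dg tdg] := tg; split => [x|v].
  exact: differentiableV.
rewrite (_ : 'D_v _ = fun x => (-1) * ((g x)^-1 * ((g x)^-1 * 'D_v g x))).
  by apply: tdZ; do 2![apply: tdM; first exact/IHm/tdW]; exact: tdg.
apply/funext => x; rewrite deriveV//; last exact: diff_derivable.
by rewrite mulN1r mulrA -invfM -expr2 scaleNr.
Qed.

End Calculus.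

Lemma td_comp_linear (R : realType) (E F : normedModType R)
    (L : {linear E -> F}) m (g : F -> R) :
  continuous L -> times_differentiable m g ->
  times_differentiable m (fun x => g (L x)).
Proof.
move=> cL; elim: m g => [//|m IHm] g [dg tg]; split => [x|v].
  apply: differentiable_comp => //; exact: linear_differentiable.
rewrite (_ : 'D_v _ = fun x => 'D_(L v) g (L x)); first exact: IHm (tg _).
apply/funext => x.
have dL : differentiable L x by exact: linear_differentiable.
rewrite deriveE; last exact: differentiable_comp.
by rewrite diff_comp// deriveE//= diff_lin.
Qed.

(** * Mean value estimates on row vectors *)

Section DifferentiableEps.
Variables (R : realType) (E : normedModType R).
Implicit Types (g : E -> R) (x : E).

Lemma differentiable_near g x (e : R) : differentiable g x -> 0 < e ->
  \forall h \near (0 : E), `|g (h + x) - g x - 'D_h g x| <= e * `|h|.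
Proof.
move=> dg e0; have /eqaddoP/(_ _ e0) := diff_locally dg.
apply: filterS => h /=.
by rewrite deriveE// !fctE /= opprD addrA.
Qed.

Lemma near_differentiable g x (L : {linear E -> R}) : continuous L ->
  (forall e, 0 < e ->
    \forall h \near (0 : E), `|g (h + x) - g x - L h| <= e * `|h|) ->
  differentiable g x /\ forall v, 'D_v g x = L v.
Proof.
move=> cL gL.
have gxL : g \o shift x = cst (g x) + L +o_ 0 id.
  apply/eqaddoP => e e0; move: (gL e e0); apply: filterS => h /=.
  by rewrite !fctE /= opprD addrA.
have dgL := diff_unique cL gxL.
have dg : differentiable g x by apply/diff_locallyP; rewrite dgL.
by split => // v; rewrite deriveE// dgL.
Qed.

Lemma MVT_lipschitz g (x y : E) (M : R) : (forall z, differentiable g z) ->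
  (forall t : R, 0 <= t <= 1 -> `|'D_(y - x) g (t *: (y - x) + x)| <= M) ->
  `|g y - g x| <= M.
Proof.
move=> dg gM.
pose l (t : R) := t *: (y - x) + x.
have dl (t : R) : is_diff t l ( *:%R ^~ (y - x) : R -> E).
  have -> : ( *:%R ^~ (y - x) : R -> E) = ( *:%R ^~ (y - x)) + 0.
    by apply/funext => s; rewrite !fctE/= addr0.
  exact: is_diffD.
have dgl (t : R) : is_derive t (1 : R) (g \o l) ('D_(y - x) g (l t)).
  have dt : differentiable (g \o l) t by exact: differentiable_comp.
  apply: DeriveDef; first exact: diff_derivable.
  rewrite deriveE// diff_comp//=.
  by rewrite (@diff_val _ _ _ _ _ _ _ (dl t)) scale1r deriveE.
have cgl : {within `[0, 1], continuous (g \o l)}.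
  apply: continuous_subspaceT => t; apply: differentiable_continuous.
  by apply/derivable1_diffP; have [] := dgl t.
have [c c01] := MVT ltr01 (fun t _ => dgl t) cgl.
rewrite /= /l scale1r scale0r add0r subrK subr0 mulr1 => ->.
by apply: gM; move: c01; rewrite in_itv/= => /andP[/ltW -> /ltW ->].
Qed.

End DifferentiableEps.

Section RowVectors.
Variables (R : realType) (N : nat).
Local Notation E := 'rV[R]_N.
Implicit Types (g : E -> R) (x v : E) (m : nat) (U : set E).
Local Notation td := times_differentiable.

Lemma rV_coord_le_norm v j : `|v 0 j| <= `|v|.
Proof.
rewrite [leRHS]/Num.norm /= mx_normrE; apply/bigmax_geP; right.
by exists (0, j).
Qed.

Lemma rV_norm_le v (e : R) : 0 <= e -> (forall j, `|v 0 j| <= e) -> `|v| <= e.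
Proof.
move=> e0 ve; rewrite [leLHS]/Num.norm /= mx_normrE; apply/bigmax_leP; split => //.
by move=> [i j] _ /=; rewrite ord1.
Qed.

Lemma derive_basis g x v : differentiable g x ->
  'D_v g x = \sum_j v 0 j * 'D_(delta_mx 0 j) g x.
Proof.
move=> dg; rewrite deriveE// [in LHS](row_sum_delta v) linear_sum.
by apply: eq_bigr => j _; rewrite linearZ/= deriveE.
Qed.

(* Only finitely many derivatives of each order are tested, so that they can be
   bounded simultaneously. *)
Fixpoint td_basis m g : Prop :=
  if m is m'.+1 then
    (forall x, differentiable g x) /\
    (forall j : 'I_N, td_basis m' ('D_(delta_mx 0 j) g))
  else True.

Lemma td_basisP m g : td_basis m g <-> td m g.
Proof.
split.
  elim: m g => [//|m IHm] g [dg tg]; split => // v.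
  rewrite (_ : 'D_v g = fun x => \sum_j v 0 j * 'D_(delta_mx 0 j) g x).
    by apply: td_sum => j; apply/tdZ/IHm/tg.
  by apply/funext => x; exact: derive_basis.
elim: m g => [//|m IHm] g [dg tg]; split => // j.
exact: IHm (tg _).
Qed.

Fixpoint dbound m U (M : R) g : Prop :=
  (forall x, U x -> `|g x| <= M) /\
  if m is m'.+1 then
    forall j : 'I_N, dbound m' U M ('D_(delta_mx 0 j) g)
  else True.

Lemma dbound0 m U M g : dbound m U M g -> forall x, U x -> `|g x| <= M.
Proof. by case: m => [|m] []. Qed.

Lemma dbound_leq m1 m2 U1 U2 M1 M2 g : (m1 <= m2)%N -> U1 `<=` U2 ->
  M2 <= M1 -> dbound m2 U2 M2 g -> dbound m1 U1 M1 g.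
Proof.
move=> m12 U12 M21; elim: m2 m1 m12 g => [|m2 IH] [|m1]//= m12 g [gM dM].
- by split => // x /U12/gM/le_trans; exact.
- by split => // x /U12/gM/le_trans; exact.
- split; first by move=> x /U12/gM/le_trans; exact.
  by move=> j; exact: IH (dM j).
Qed.

Lemma dboundZ m U M (c : R) g : td m g -> dbound m U M g ->
  dbound m U (`|c| * M) (fun x => c * g x).
Proof.
elim: m g => [|m IHm] g tg /= [gM dM].
  by split => // x Ux; rewrite normrM ler_wpM2l ?gM.
split=> [x Ux|j]; first by rewrite normrM ler_wpM2l ?gM.
have [dg tdg] := tg.
rewrite (_ : 'D__ _ = fun x => c * 'D_(delta_mx 0 j) g x).
  exact: IHm (tdg _) (dM j).
by apply/funext => x; apply: (@deriveZ _ _ _ g c); exact: diff_derivable.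
Qed.

Lemma dbound_eq0 m U g M : open U -> 0 <= M -> (forall x, U x -> g x = 0) ->
  dbound m U M g.
Proof.
move=> oU M0; elim: m g => [|m IHm] g g0 /=.
  by split => // x Ux; rewrite g0// normr0.
split=> [x Ux|j]; first by rewrite g0// normr0.
apply: IHm => x Ux.
rewrite -(@derive_cst R E R 0 x (delta_mx 0 j)).
have [->|dj0] := eqVneq (delta_mx 0 j : E) 0; first by rewrite !derive0.
by apply: near_eq_derive => //; exact: filterS g0 (open_nbhs_nbhs _).
Qed.

Lemma dbound_derive m x0 (r M : R) g v x : td m.+1 g ->
  dbound m.+1 (ball x0 r) M g ->
  ball x0 r x -> `|'D_v g x| <= N%:R * (M * `|v|).
Proof.
move=> [dg _] [gM dM] xr; rewrite derive_basis//.
apply: (le_trans (ler_norm_sum _ _ _)).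
have -> : N%:R * (M * `|v|) = \sum_(i < N) (M * `|v|).
  by rewrite sumr_const card_ord mulr_natl.
apply: ler_sum => j _; rewrite normrM mulrC.
by apply: ler_pM => //; [exact: dbound0 (dM j) _ _|exact: rV_coord_le_norm].
Qed.

Lemma dbound_lipschitz x0 (r M : R) g x y : td 1 g ->
  dbound 1 (ball x0 r) M g -> ball x0 r x -> ball x0 r y ->
  `|g y - g x| <= N%:R * (M * `|y - x|).
Proof.
move=> tg gM xr yr; apply: MVT_lipschitz; first by case: tg.
move=> t /andP[t0 t1]; apply: (dbound_derive _ tg gM).
move: xr yr; rewrite -ball_normE /= => xr yr.
rewrite (_ : x0 - _ = (1 - t) *: (x0 - x) + t *: (x0 - y)); last first.
  by apply/rowP => j; rewrite !mxE; ring.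
have [->|tn0] := eqVneq t 0.
  by rewrite subr0 scale1r scale0r addr0.
apply: (le_lt_trans (ler_normD _ _)); rewrite !normrZ.
rewrite (ger0_norm t0) ger0_norm ?subr_ge0//.
rewrite [ltRHS](_ : r = (1 - t) * r + t * r); last by ring.
apply: ler_ltD; first by rewrite ler_wpM2l ?subr_ge0// ltW.
by rewrite ltr_pM2l// lt_neqAle eq_sym tn0.
Qed.

End RowVectors.

(** * Smooth series *)

Section GeometricTails.
Variable R : realType.
Implicit Types (a : R^nat) (K : nat) (c : R).

Lemma half_pow_small (e : R) I : 0 < e ->
  exists2 K, (I <= K)%N & 2^-1 ^+ K <= e.
Proof.
move=> e0.
have h1 : `|2^-1 : R| < 1 by rewrite ger0_norm ?invr_ge0// invf_lt1// ltr1n.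
near \oo => K; exists K; first by near: K; exact: nbhs_infty_ge.
rewrite -[leLHS]ger0_norm ?exprn_ge0 ?invr_ge0//; near: K.
by apply: (cvgr0_norm_le _ (cvg_expr h1)).
Unshelve. all: by end_near. Qed.

Lemma half_pow_sum_le K p :
  \sum_(K <= i < K + p) (2^-1 : R) ^+ i <= 2^-1 ^+ K * 2.
Proof.
suff -> : \sum_(K <= i < K + p) (2^-1 : R) ^+ i =
    2^-1 ^+ K * 2 - 2^-1 ^+ (K + p) * 2.
  by rewrite gerBl mulr_ge0// exprn_ge0// invr_ge0.
elim: p => [|p IHp]; first by rewrite addn0 big_geq// subrr.
by rewrite addnS big_nat_recr ?leq_addr//= IHp exprS; field.
Qed.

Lemma half_pow_tail a K c n : (K <= n)%N ->
  (forall i, (K <= i)%N -> `|a i| <= c * 2^-1 ^+ i) ->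
  `|series a n - series a K| <= c * (2^-1 ^+ K * 2).
Proof.
move=> Kn ha; rewrite sub_series_geq//.
have c0 : 0 <= c.
  have /le_trans := normr_ge0 (a K) => /(_ _ (ha _ (leqnn K))).
  by rewrite pmulr_lge0// exprn_gt0// invr_gt0.
apply: (le_trans (ler_norm_sum _ _ _)).
rewrite -(subnKC Kn); apply: le_trans (ler_wpM2l c0 (half_pow_sum_le K (n - K))).
rewrite mulr_sumr big_nat_cond [leRHS]big_nat_cond; apply: ler_sum => i.
by rewrite andbT => /andP[/ha].
Qed.

Lemma half_pow_cvg a K c :
  (forall i, (K <= i)%N -> `|a i| <= c * 2^-1 ^+ i) -> cvgn (series a).
Proof.
move=> ha; apply: normed_cvg; apply: nondecreasing_is_cvgn.
  by apply: nondecreasing_series => i *; rewrite normr_ge0.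
exists (series (fun i => `|a i|) K + c * (2^-1 ^+ K * 2)) => _ [n _ <-].
have ha' i : (K <= i)%N -> `| `|a i| | <= c * 2^-1 ^+ i.
  by rewrite normr_id; exact: ha.
have c0 : 0 <= c.
  have /le_trans := normr_ge0 (a K) => /(_ _ (ha _ (leqnn K))).
  by rewrite pmulr_lge0// exprn_gt0// invr_gt0.
have [Kn|/ltnW nK] := leqP K n.
  rewrite -lerBlDl; apply: le_trans (half_pow_tail Kn ha').
  exact: ler_norm.
apply: (@le_trans _ _ (series (fun i => `|a i|) K)).
  by apply: nondecreasing_series => // i *; rewrite normr_ge0.
by rewrite lerDl !mulr_ge0// exprn_ge0// invr_ge0.
Qed.

Lemma half_pow_lim_tail a K c :
  (forall i, (K <= i)%N -> `|a i| <= c * 2^-1 ^+ i) ->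
  `|limn (series a) - series a K| <= c * (2^-1 ^+ K * 2).
Proof.
move=> ha; have ca := half_pow_cvg ha.
have cb : (series a n - series a K) @[n --> \oo] --> limn (series a) - series a K.
  by apply: cvgB => //; exact: cvg_cst.
apply: (cvgr_to_le (cvg_norm cb)).
by near=> n; apply: half_pow_tail => //; near: n; exact: nbhs_infty_ge.
Unshelve. all: by end_near. Qed.

End GeometricTails.

Section SmoothSeries.
Variables (R : realType) (N : nat).
Local Notation E := 'rV[R]_N.
Local Notation td := times_differentiable.
Implicit Type g : nat -> E -> R.

Definition fsum g (x : E) : R := limn (series (g ^~ x)).

Definition fast_near m g := forall x0 : E, exists2 r : R, 0 < r &
  exists I, forall i, (I <= i)%N -> dbound m (ball x0 r) (2^-1 ^+ i) (g i).

Lemma fast_near_leq m1 m2 g : (m1 <= m2)%N -> fast_near m2 g -> fast_near m1 g.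
Proof.
move=> m12 fg x0; have [r r0 [I gI]] := fg x0; exists r => //; exists I => i Ii.
exact: dbound_leq (gI i Ii).
Qed.

Lemma fast_near_derive m g (j : 'I_N) : fast_near m.+1 g ->
  fast_near m (fun i => 'D_(delta_mx 0 j) (g i)).
Proof.
move=> fg x0; have [r r0 [I gI]] := fg x0; exists r => //; exists I => i Ii.
by have [_] := gI i Ii; exact.
Qed.

Lemma fast_near_cvg m g x : fast_near m g -> cvgn (series (g ^~ x)).
Proof.
move=> /(_ x)[r r0 [I gI]]; apply: (@half_pow_cvg _ _ I 1) => i Ii.
by rewrite mul1r; apply: (dbound0 (gI i Ii)); exact: ballxx.
Qed.

Lemma fsum_differentiable g x0 : (forall i, td 1 (g i)) -> fast_near 1 g ->
  differentiable (fsum g) x0 /\ forall j : 'I_N,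
  'D_(delta_mx 0 j) (fsum g) x0 = fsum (fun i => 'D_(delta_mx 0 j) (g i)) x0.
Proof.
move=> tg fg; have [r r0 [I gI]] := fg x0.
pose S (j : 'I_N) := fsum (fun i => 'D_(delta_mx 0 j) (g i)) x0.
pose Lf (v : E) : R := \sum_j v 0 j * S j.
have Llin : linear Lf.
  move=> a u v; rewrite /Lf scaler_sumr -big_split; apply: eq_bigr => j _ /=.
  by rewrite !mxE mulrDl scalerAl.
pose L : {linear E -> R} := HB.pack Lf (GRing.isLinear.Build _ _ _ _ _ Llin).
have cL : continuous (L : E -> R).
  rewrite (_ : (L : E -> R) = Lf)//.
  apply: (@continuous_sum R E _ _ (fun j (v : E) => v 0 j * S j)) => j v.
  exact: (cvgM (@coord_continuous R 1 N 0 j v) (cvg_cst _)).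
suff [dG DG] : differentiable (fsum g) x0 /\ forall v, 'D_v (fsum g) x0 = L v.
  split => // j; rewrite DG /= /Lf (bigD1 j)//= big1 ?mxE ?eqxx ?mul1r ?addr0//.
  by move=> k kj; rewrite mxE (negPf kj) andbF mul0r.
apply: near_differentiable => // e e0.
have N0 : (0 : R) < N.+1%:R by rewrite ltr0n.
have [K IK hK] := @half_pow_small R (e / 2 / (4 * N.+1%:R)) I
  ltac:(by rewrite !divr_gt0// mulr_gt0).
pose P (x : E) := \sum_(0 <= i < K) g i x.
have tP : td 1 P by apply: td_sum.
have dP : differentiable P x0 by case: tP.
have e20 : 0 < e / 2 by rewrite divr_gt0.
have nearP := differentiable_near dP e20.
near=> h.
have hr : ball x0 r (h + x0).
  rewrite -ball_normE /= opprD addrCA subrr addr0 normrN.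
  by near: h; exact: cvgr0_norm_lt.
have xr : ball x0 r x0 by exact: ballxx.
have Ph : `|P (h + x0) - P x0 - 'D_h P x0| <= e / 2 * `|h|.
  by near: h; exact: nearP.
have Gh : `|(fsum g (h + x0) - fsum g x0) - (P (h + x0) - P x0)|
    <= N%:R * `|h| * (2^-1 ^+ K * 2).
  have -> : fsum g (h + x0) - fsum g x0 =
      limn (series ((g ^~ (h + x0)) - (g ^~ x0))).
    by rewrite lim_seriesB//; exact: fast_near_cvg fg.
  have -> : P (h + x0) - P x0 = series ((g ^~ (h + x0)) - (g ^~ x0)) K.
    by rewrite /P -sumrB.
  apply: half_pow_lim_tail => i Ki.
  have := dbound_lipschitz (tg i) (gI i (leq_trans IK Ki)) xr hr.
  by rewrite addrK -mulrA [`|h| * _]mulrC.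
have Dh : `|'D_h P x0 - L h| <= N%:R * `|h| * (2^-1 ^+ K * 2).
  have -> : 'D_h P x0 =
      \sum_j h 0 j * series (fun i => 'D_(delta_mx 0 j) (g i) x0) K.
    rewrite derive_basis//; apply: eq_bigr => j _; congr (_ * _).
    rewrite /series/= (_ : P = \sum_(i < K) g i).
      rewrite derive_sum ?big_mkord// => i.
      by apply: diff_derivable; case: (tg i).
    by apply/funext => x; rewrite fct_sumE /P big_mkord.
  rewrite /= /Lf -sumrB; apply: (le_trans (ler_norm_sum _ _ _)).
  rewrite -mulrA; have -> : N%:R * (`|h| * (2^-1 ^+ K * 2)) =
    \sum_(j < N) (`|h| * (2^-1 ^+ K * 2)).
    by rewrite sumr_const card_ord mulr_natl.
  apply: ler_sum => j _; rewrite -mulrBr normrM distrC.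
  apply: ler_pM => //; first exact: rV_coord_le_norm.
  rewrite -[leRHS]mul1r; apply: half_pow_lim_tail => i Ki; rewrite mul1r.
  have [_ /(_ j)[+ _]] := gI i (leq_trans IK Ki); exact.
have -> : fsum g (h + x0) - fsum g x0 - L h =
  (P (h + x0) - P x0 - 'D_h P x0) +
  ((fsum g (h + x0) - fsum g x0) - (P (h + x0) - P x0)) + ('D_h P x0 - L h).
  by rewrite /=; ring.
apply: (le_trans (ler_normD _ _)).
have := lerD (le_trans (ler_normD _ _) (lerD Ph Gh)) Dh.
move=> /le_trans; apply.
have hK' : 2^-1 ^+ K * (4 * N.+1%:R) <= e / 2.
  by rewrite -ler_pdivlMr// mulr_gt0.
have h0 : 0 <= `|h| by [].
have : `|h| * (2^-1 ^+ K * (4 * N.+1%:R)) <= `|h| * (e / 2) by rewrite ler_wpM2l.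
have : 0 <= `|h| * (2^-1 ^+ K * 4).
  by rewrite !mulr_ge0// exprn_ge0// invr_ge0.
have -> : N.+1%:R = N%:R + 1 :> R by rewrite natr1.
set a := 2^-1 ^+ K; set b := N%:R; lra.
Unshelve. all: by end_near. Qed.

Lemma fsum_td m g : (forall i, td m (g i)) -> fast_near m g -> td m (fsum g).
Proof.
move=> tg fg; apply/td_basisP.
elim: m g tg fg => [//|m IHm] g tg fg.
have tg1 i : td 1 (g i) by exact: td_leq (tg i).
have fg1 : fast_near 1 g by exact: fast_near_leq fg.
split=> [x|j]; first by have [] := fsum_differentiable x tg1 fg1.
rewrite (_ : 'D__ _ = fsum (fun i => 'D_(delta_mx 0 j) (g i))).
  by apply: IHm => [i|]; [have [_] := tg i; exact|exact: fast_near_derive].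
by apply/funext => x; have [_] := fsum_differentiable x tg1 fg1; exact.
Qed.

Lemma continuous_bounded_ball (r : R) (g : E -> R) : continuous g ->
  exists2 M : R, 0 <= M & forall x, ball (0 : E) r x -> `|g x| <= M.
Proof.
move=> cg; have cB : compact (closed_ball_ Num.norm (0 : E) r).
  apply: bounded_closed_compact; last exact: closed_closed_ball_.
  exists r; split; first exact: num_real.
  move=> s rs x; rewrite /closed_ball_/= sub0r normrN => /le_trans; apply.
  exact: ltW.
have /compact_bounded[M [_ MB]] :=
  continuous_compact (continuous_subspaceT cg) cB.
exists (`|M| + 1) => [|x xr]; first by rewrite addr_ge0.
apply: (MB (`|M| + 1)); first by rewrite (le_lt_trans (ler_norm _))// ltrDl.
by exists x => //; move: xr; rewrite -ball_normE /= => /ltW.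
Qed.

Lemma smooth_dbound m (r : R) (g : E -> R) : smooth g ->
  exists M : R, 0 <= M /\ dbound m (ball (0 : E) r) M g.
Proof.
elim: m g => [|m IHm] g sg.
all: have [M M0 gM] : exists2 M : R, 0 <= M &
  forall x, ball (0 : E) r x -> `|g x| <= M by
  apply: continuous_bounded_ball => x; apply: differentiable_continuous;
  case: (sg 1%N).
  by exists M; split=> //; split.
have /choice[f fb] : forall j : 'I_N, exists M : R, 0 <= M /\
    dbound m (ball (0 : E) r) M ('D_(delta_mx 0 j) g).
  by move=> j; apply: IHm => k; have [_] := sg k.+1; exact.
have f0 j : 0 <= f j by case: (fb j).
exists (M + \sum_j f j); split; first by rewrite addr_ge0// sumr_ge0.
split=> [x /gM/le_trans|j].
  by apply; rewrite lerDl sumr_ge0.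
have [_] := fb j; apply: dbound_leq => //.
by rewrite (bigD1 j)//= addrCA lerDl addr_ge0// sumr_ge0.
Qed.

Lemma fast_coef (g : nat -> nat -> E -> R) : (forall i k, smooth (g i k)) ->
  exists c : nat -> R, (forall i, 0 < c i) /\
  forall i k d, (k <= i)%N -> 0 <= d <= c i ->
    dbound i (ball (0 : E) i%:R) (2^-1 ^+ i) (fun x => d * g i k x).
Proof.
move=> sg.
have /choice[M HM] : forall i, exists M : R, 0 <= M /\ forall k, (k <= i)%N ->
    dbound i (ball (0 : E) i%:R) M (g i k).
  move=> i; have /choice[f fb] := fun k => smooth_dbound i i%:R (sg i k).
  have f0 k : 0 <= f k by case: (fb k).
  exists (\sum_(k < i.+1) f k); split; first by rewrite sumr_ge0.
  move=> k ki; have [_] := fb k; apply: dbound_leq => //.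
  rewrite (bigD1 (Ordinal (ki : (k < i.+1)%N)))//= lerDl sumr_ge0//.
exists (fun i => 2^-1 ^+ i / (1 + M i)); split=> [i|i k d ki /andP[d0 dc]].
  by rewrite divr_gt0 ?exprn_gt0 ?invr_gt0// ltr_pwDl//; case: (HM i).
have [M0 Mb] := HM i.
apply: (dbound_leq (leqnn i) (@subset_refl _ _) _ (dboundZ d (sg i k i) (Mb k ki))).
rewrite ger0_norm//; apply: (@le_trans _ _ (d * (1 + M i))).
  by rewrite ler_wpM2l// lerDr.
by rewrite -ler_pdivlMr// ltr_pwDl.
Qed.

End SmoothSeries.

(** * Smooth separation of open sets *)

Section FlatFunction.
Variable R : realType.
Implicit Types (k : nat) (t : R).

Definition flat k t : R :=
  if 0 < t then t^-1 ^+ k * expR (- t^-1) else 0.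

Lemma flat_ge0 k t : 0 <= flat k t.
Proof.
rewrite /flat; case: ifPn => // t0.
by rewrite mulr_ge0 ?expR_ge0// exprn_ge0// invr_ge0 ltW.
Qed.

Lemma flat_gt0 k t : (0 < flat k t) = (0 < t).
Proof.
rewrite /flat; case: ifPn => [t0|]; last by rewrite ltxx.
by rewrite mulr_gt0 ?expR_gt0// exprn_gt0// invr_gt0.
Qed.

Lemma flat_scale k t : flat k t = t * flat k.+1 t.
Proof.
rewrite /flat; case: ifPn => t0; last by rewrite mulr0.
by rewrite exprS !mulrA divff ?gt_eqF// mul1r.
Qed.

Lemma flat_le k t : flat k.+1 t <= k.+1`!%:R.
Proof.
rewrite /flat; case: ifPn => // t0; rewrite expRN ler_pdivrMr ?expR_gt0//.
have t10 : 0 <= t^-1 by rewrite invr_ge0 ltW.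
have := expR_ge1Dxn k t10.
have f0 : 0 < k.+1`!%:R :> R by rewrite ltr0n fact_gt0.
move=> H; rewrite -ler_pdivrMl// mulrC; apply: le_trans H.
by rewrite lerDr.
Qed.

Lemma flat_is_derive k t :
  is_derive t (1 : R) (flat k) (- k%:R * flat k.+1 t + flat k.+2 t).
Proof.
have [t0|t0|->] := ltgtP t 0.
- apply: (@near_eq_is_derive _ _ _ (cst 0)); last first.
    rewrite /flat ltNge (ltW t0)/= mulr0 addr0; exact: is_derive_cst.
  near=> s; rewrite /flat ltNge (_ : s <= 0)//=.
  by apply: ltW; near: s; exact: lt_nbhsl.
- apply: (@near_eq_is_derive _ _ _ (fun s : R => s^-1 ^+ k * expR (- s^-1))).
    near=> s; rewrite /flat (_ : 0 < s)//.
    by near: s; exact: lt_nbhsr.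
  have d1 : is_derive t (1 : R) (fun s : R => s^-1) (- t ^- 2).
    have tn0 : t != 0 by rewrite gt_eqF.
    apply: is_derive_eq (@is_deriveV R id t 1 1 tn0 (is_derive_id _ _)) _.
    by rewrite /GRing.scale/= mulr1.
  have d2 : is_derive t (1 : R) (fun s : R => expR (- s^-1))
      (t ^- 2 * expR (- t^-1)).
    have -> : (fun s : R => expR (- s^-1)) = expR \o (fun s : R => - s^-1) by [].
    apply: is_derive_eq.
    by rewrite opprK mulrC.
  have dX := is_deriveX k d1.
  have -> : (fun s : R => s^-1 ^+ k * expR (- s^-1)) =
      (fun s : R => s^-1) ^+ k * (fun s : R => expR (- s^-1)).
    by apply/funext => s; rewrite !fctE.
  apply: is_derive_eq (is_deriveM dX d2) _.
  rewrite /flat t0 fctE /= /GRing.scale/=.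
  case: k {dX} => [|k]; first by rewrite expr0; field; rewrite gt_eqF.
  rewrite -[k.+1.-1]/k -exprVn; set b := k.+1%:R; set u := t^-1.
  by rewrite !exprS expr0; ring.
have cL : continuous (\0 : {linear R -> R}) by move=> ?; exact: cvg_cst.
have flat0 i : flat i 0 = 0 by rewrite /flat ltxx.
have [] := @near_differentiable R R (flat k) 0 (\0 : {linear R -> R}) cL.
  move=> e e0; have C0 : 0 < k.+2`!%:R :> R by rewrite ltr0n fact_gt0.
  near=> h; rewrite addr0 flat0 !subr0 flat_scale normrM.
  rewrite mulrC ler_wpM2r// ger0_norm ?flat_ge0// flat_scale.
  have [h0|h0] := ltP 0 h; last first.
    by rewrite /flat ltNge h0 mulr0 ltW.
  apply: (@le_trans _ _ (h * k.+2`!%:R)); first by rewrite ler_wpM2l ?flat_le// ltW.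
  rewrite -ler_pdivlMr//; apply/ltW/(le_lt_trans (ler_norm h)).
  by near: h; apply: cvgr0_norm_lt => //; rewrite divr_gt0.
move=> df D; rewrite !flat0 mulr0 addr0; apply: DeriveDef; first exact: diff_derivable.
by rewrite D.
Unshelve. all: by end_near. Qed.

Lemma flat_comp_td (E : normedModType R) m k (q : E -> R) :
  times_differentiable m q -> times_differentiable m (fun x => flat k (q x)).
Proof.
elim: m k => [//|m IHm] k tq; have [dq tdq] := tq.
have df t : differentiable (flat k) t.
  by apply/derivable1_diffP; have [] := flat_is_derive k t.
split => [x|v]; first exact: differentiable_comp.
rewrite (_ : 'D_v _ =
  fun x => (- k%:R * flat k.+1 (q x) + flat k.+2 (q x)) * 'D_v q x).
  apply: tdM; last exact: tdq.
  by apply: tdD; [apply: tdZ|]; apply: IHm; exact: tdW.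
apply/funext => x; rewrite deriveE; last exact: differentiable_comp.
rewrite diff_comp//= diff1E//= -deriveE// derive1E mulrC.
by rewrite (@derive_val _ _ _ _ _ _ _ (flat_is_derive k (q x))).
Qed.

End FlatFunction.

Section OpenSets.
Variables (R : realType) (N : nat).
Local Notation E := 'rV[R]_N.
Implicit Types (x y : E) (U : set E) (K : nat) (a : 'rV[int]_N).

Lemma fast_near_ball (h : nat -> E -> R) m I0 :
  (forall i, (I0 <= i)%N -> dbound i (ball (0 : E) i%:R) (2^-1 ^+ i) (h i)) ->
  fast_near m h.
Proof.
move=> hb x0; exists 1 => //.
exists (maxn (maxn I0 m) (Num.truncn (`|x0| + 1)).+1) => i.
rewrite !geq_max => /andP[/andP[I0i mi] xi].
apply: dbound_leq (hb i I0i) => // y; rewrite -!ball_normE/= sub0r normrN => xy.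
apply: (@lt_le_trans _ _ (`|x0| + 1)).
  rewrite -(subrK x0 y) addrC; apply: (le_lt_trans (ler_normD _ _)).
  by rewrite ltrD2l distrC.
apply/ltW; apply: lt_le_trans (_ : (Num.truncn (`|x0| + 1)).+1%:R <= _).
  exact: truncnS_gt.
by rewrite ler_nat.
Qed.

Lemma fsum_ge_partial (g : nat -> E -> R) x n : (forall i, 0 <= g i x) ->
  cvgn (series (g ^~ x)) -> \sum_(0 <= i < n) g i x <= fsum g x.
Proof.
move=> g0 cg; apply: (nondecreasing_cvgn_le _ cg).
by apply: nondecreasing_series => i *; exact: g0.
Qed.

Lemma fsum_le (g : nat -> E -> R) x c : cvgn (series (g ^~ x)) ->
  (forall n, \sum_(0 <= i < n) g i x <= c) -> fsum g x <= c.
Proof. by move=> cg gc; apply: limr_le => //; near=> n; exact: gc.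
Unshelve. all: by end_near. Qed.

Definition lattice_poly (aK : 'rV[int]_N * nat) x : R :=
  N.+1%:R - \sum_j (aK.2.+1%:R * x 0 j - (aK.1 0 j)%:~R) ^+ 2.

Definition lattice_bump aK x : R := flat 0 (lattice_poly aK x).

Lemma coord_td m (j : 'I_N) : times_differentiable m (fun x : E => x 0 j).
Proof.
case: m => [//|m]; split => [x|v]; first exact: differentiable_coord.
rewrite (_ : 'D_v _ = fun=> v 0 j); first exact: td_cst.
apply/funext => x; apply: derive_val; apply: DeriveDef.
  exact/diff_derivable/differentiable_coord.
apply: cvg_lim => //; apply: (@cvg_trans _ (v 0 j @[h --> (0 : R)^'])).
  apply: near_eq_cvg; near=> h.
  have h0 : h != 0 by near: h; exact: nbhs_dnbhs_neq.
  by rewrite /= !mxE addrK /GRing.scale/= mulKf.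
exact: cvg_cst.
Unshelve. all: by end_near. Qed.

Lemma lattice_bump_smooth aK : smooth (lattice_bump aK).
Proof.
move=> m; apply: flat_comp_td.
have tl j : times_differentiable m (fun x : E => aK.2.+1%:R * x 0 j - (aK.1 0 j)%:~R).
  by apply: tdD; [exact/tdZ/coord_td|exact: td_cst].
apply: (@tdD _ _ _ (fun=> N.+1%:R)); first exact: td_cst.
rewrite (_ : (fun _ => - _) = fun x => -1 * \sum_j
  ((aK.2.+1%:R * x 0 j - (aK.1 0 j)%:~R) * (aK.2.+1%:R * x 0 j - (aK.1 0 j)%:~R))).
  by apply: tdZ; apply: td_sum => j; exact: tdM.
by apply/funext => x; rewrite mulN1r.
Qed.

Lemma lattice_bump_cover x K : exists a, 0 < lattice_bump (a, K) x.
Proof.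
exists (\row_j Num.floor (K.+1%:R * x 0 j)); rewrite flat_gt0 subr_gt0 /=.
rewrite -[ltRHS]natr1; apply: (@le_lt_trans _ _ N%:R); last by rewrite ltrDl.
rewrite -[leRHS]mulr1 mulr_natl -[X in _ <= _ *+ X]card_ord -sumr_const.
apply: ler_sum => j _; rewrite mxE.
have /andP[lo hi] := floor_itv (K.+1%:R * x 0 j).
rewrite expr_le1// ?subr_ge0//.
by rewrite lerBlDr addrC ltW// -[X in _ < _ + X](mulr1z 1) -intrD.
Qed.

Lemma lattice_bump_diam aK x y : 0 < lattice_bump aK x ->
  0 < lattice_bump aK y -> `|x - y| <= 2 * N.+1%:R / aK.2.+1%:R.
Proof.
have bnd z j : 0 < lattice_bump aK z ->
    `|aK.2.+1%:R * z 0 j - (aK.1 0 j)%:~R| <= N.+1%:R.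
  rewrite flat_gt0 subr_gt0 => zN.
  rewrite -(@ler_pXn2r _ 2)// ?nnegrE// real_normK ?num_real//.
  apply: (@le_trans _ _ N.+1%:R); last first.
    by rewrite -natrX ler_nat leq_pmulr.
  apply: le_trans (ltW zN); rewrite [leRHS](bigD1 j)//= lerDl sumr_ge0// => i _.
  exact: sqr_ge0.
move=> hx hy; apply: rV_norm_le => [|j]; first by rewrite divr_ge0// mulr_ge0.
rewrite ler_pdivlMr// mulrC -[X in X * _]gtr0_norm// -normrM !mxE.
have -> : aK.2.+1%:R * (x 0 j - y 0 j) =
  (aK.2.+1%:R * x 0 j - (aK.1 0 j)%:~R) - (aK.2.+1%:R * y 0 j - (aK.1 0 j)%:~R).
  by ring.
apply: (le_trans (ler_normB _ _)).
have -> : 2 * N.+1%:R = N.+1%:R + N.+1%:R :> R by ring.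
by apply: lerD; apply: bnd.
Qed.

Lemma smooth_pos_open U : open U ->
  exists psi : E -> R, [/\ smooth psi, forall x, 0 <= psi x &
    forall x, (0 < psi x) <-> U x].
Proof.
move=> oU.
pose g i (x : E) : R := if unpickle i is Some aK then
  if `[< forall y, 0 < lattice_bump aK y -> U y >] then lattice_bump aK x else 0
  else 0.
have sg i : smooth (g i).
  move=> m; rewrite /g; case: (unpickle i) => [aK|]; last exact: td_cst.
  by case: `[< _ >]; [exact: lattice_bump_smooth|exact: td_cst].
have g0 i x : 0 <= g i x.
  rewrite /g; case: (unpickle i) => // aK; case: ifP => // _; exact: flat_ge0.
have [c [c0 cg]] := @fast_coef R N (fun i _ => g i) (fun i _ => sg i).
pose h i x := c i * g i x.
have fh m : fast_near m h.
  apply: (@fast_near_ball _ _ 0) => i _; apply: (cg i 0%N) => //.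
  by rewrite lexx ltW.
have h0 i x : 0 <= h i x by rewrite mulr_ge0// ltW.
have ch x : cvgn (series (h ^~ x)) by exact: fast_near_cvg (fh 0%N).
exists (fsum h); split => [m|x|x].
- by apply: fsum_td => // i; apply: tdZ; exact: sg.
- by have := fsum_ge_partial 0 (fun i => h0 i x) (ch x); rewrite big_geq.
split => [hx|Ux].
  apply: contrapT => nUx; move: hx; apply/negP; rewrite -leNgt.
  apply: fsum_le => // n; rewrite big1// => i _.
  rewrite /h /g; case: (unpickle i) => [aK|]; last by rewrite mulr0.
  case: ifPn => [/asboolP aU|]; last by rewrite mulr0.
  rewrite (_ : lattice_bump aK x = 0) ?mulr0//; apply/eqP.
  by rewrite eq_le flat_ge0 andbT leNgt; apply/negP => /aU.
have /nbhs_ballP[e e0 eU] := open_nbhs_nbhs (conj oU Ux).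
pose K := Num.truncn (2 * N.+1%:R / e).
have [a ax] := lattice_bump_cover x K.
have aU y : 0 < lattice_bump (a, K) y -> U y.
  move=> ay; apply: eU; rewrite -ball_normE /=.
  apply: le_lt_trans (lattice_bump_diam ax ay) _.
  by rewrite ltr_pdivrMr// [e * _]mulrC -ltr_pdivrMr//; exact: truncnS_gt.
apply: lt_le_trans (fsum_ge_partial (pickle (a, K)).+1 (fun i => h0 i x) (ch x)).
rewrite big_nat_recr//= ltr_wpDl ?sumr_ge0//.
by rewrite mulr_gt0// /g pickleK ifT//; exact/asboolP.
Qed.

Lemma smooth_urysohn (U1 U2 : set E) : open U1 -> open U2 ->
  (forall x, U1 x \/ U2 x) ->
  exists theta : E -> R, [/\ smooth theta, forall x, 0 <= theta x <= 1,
    forall x, ~ U1 x -> theta x = 0 & forall x, ~ U2 x -> theta x = 1].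
Proof.
move=> /smooth_pos_open[p [sp p0 pU]] /smooth_pos_open[q [sq q0 qU]] U12.
have pq0 x : 0 < p x + q x.
  by have [/pU|/qU] := U12 x => h; [rewrite ltr_pwDl|rewrite ltr_pwDr].
exists (fun x => p x * (p x + q x)^-1); split => [m|x|x nU|x nU].
- by apply: tdM; [exact: sp|apply: tdV => [x|]; [rewrite gt_eqF|exact: tdD]].
- rewrite divr_ge0 ?(ltW (pq0 x))//=.
  by rewrite ler_pdivrMr// mul1r lerDl.
- rewrite (_ : p x = 0) ?mul0r//; apply/eqP.
  by rewrite eq_le p0 andbT leNgt; apply/negP => /pU.
have -> : q x = 0.
  by apply/eqP; rewrite eq_le q0 andbT leNgt; apply/negP => /qU.
rewrite addr0 divff// gt_eqF//.
by have := pq0 x; rewrite (_ : q x = 0) ?addr0//; apply/eqP;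
  rewrite eq_le q0 andbT leNgt; apply/negP => /qU.
Qed.

End OpenSets.

(** * Smoothing a strictly decreasing function *)

Lemma finite_pos_min (R : realType) (f : nat -> R) (I : nat) :
  (forall j, 0 < f j) -> exists2 e, 0 < e & forall j, (j < I)%N -> e <= f j.
Proof.
move=> f0; elim: I => [|I [e e0 ef]]; first by exists 1.
exists (Num.min e (f I)) => [|j]; first by rewrite lt_min e0 f0.
rewrite ltnS leq_eqVlt ge_min => /predU1P[->|/ef ->//].
by rewrite lexx orbT.
Qed.

Lemma sum_indic_le (R : realType) (v : R) n : 0 <= v ->
  \sum_(0 <= i < n) (i.+1%:R <= v)%R%:R <= v.
Proof.
move=> v0; suff : \sum_(0 <= i < n) (i.+1%:R <= v)%R%:R <= n%:R :> R /\
    \sum_(0 <= i < n) (i.+1%:R <= v)%R%:R <= v by case.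
elim: n => [|n [IH1 IH2]]; first by rewrite big_geq.
rewrite big_nat_recr//= -[X in _ <= X /\ _]natr1.
have [nv|nv] := leP n.+1%:R v; last first.
  by rewrite addr0; split => //; rewrite (le_trans IH1)// lerDl.
by split; [exact: lerD|apply: le_trans nv; rewrite -natr1; exact: lerD].
Qed.

Section SmoothLyapunov.
Variables (R : realType) (N : nat).
Local Notation E := 'rV[R]_N.
Variables (V : int -> E -> R) (F : int -> E -> E).
Hypothesis V_ge0 : forall k x, 0 <= V k x.
Hypothesis V_lt_open : forall k (c : R), 0 < c -> open [set x | V k x < c].
Hypothesis V_gt_open : forall k (c : R), 0 < c -> open [set x | c < V k x].
Hypothesis V_noninc : forall k x, V (k + 1) (F k x) <= V k x.
Hypothesis V_decay : forall a B : R, 0 < a -> exists2 l : R, 2^-1 <= l < 1 &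
  forall k x, a <= V k x <= B -> V (k + 1) (F k x) <= l * V k x.

(* One step takes the sublevel set of [q] into that of [p], so that a function
   equal to 0 on the latter and to 1 off the former cannot increase. *)
Definition gap (p q : R) : Prop :=
  0 < p < q /\ forall k x, V k x < q -> V (k + 1) (F k x) <= p.

Lemma gap_above p : 0 < p -> exists q, gap p q.
Proof.
move=> p0; have [l /andP[l2 l1] Vl] := @V_decay p (2 * p) p0.
have l0 : 0 < l by apply: lt_le_trans l2; rewrite invr_gt0.
exists (p / l); split; first by rewrite p0 ltr_pdivlMr// gtr_pMr.
move=> k x; rewrite ltr_pdivlMr// => Vp.
have [/ltW pV|pV] := ltP (V k x) p; first exact: le_trans (V_noninc k x) _.
apply: le_trans (Vl k x _) _; last by rewrite mulrC ltW.
rewrite pV/=; have : V k x * 2^-1 <= V k x * l by rewrite ler_wpM2l.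
lra.
Qed.

Definition grid_pair (iK : nat * nat) : R * R :=
  (iK.1.+1%:R / iK.2.+1%:R, iK.1.+2%:R / iK.2.+1%:R).

Lemma gap_grid a B : 0 < a -> exists K I : nat, forall k x,
  a <= V k x <= B -> exists i : nat, [/\ (i < I)%N,
    gap (grid_pair (i, K)).1 (grid_pair (i, K)).2,
    (grid_pair (i, K)).2 <= V k x &
    V (k + 1) (F k x) <= (grid_pair (i, K)).1].
Proof.
move=> a0; have a20 : 0 < a / 2 by rewrite divr_gt0.
have [l /andP[l2 l1] Vl] := @V_decay (a / 2) B a20.
have l0 : 0 < l by apply: lt_le_trans l2; rewrite invr_gt0.
have al0 : 0 < a * (1 - l) by rewrite mulr_gt0// subr_gt0.
pose K := Num.truncn (4 / (a * (1 - l))).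
have K0 : 0 < K.+1%:R :> R by [].
have hK : 4 < K.+1%:R * (a * (1 - l)) by rewrite -ltr_pdivrMr// truncnS_gt.
exists K, (Num.truncn (B * K.+1%:R)).+1 => k x /andP[aV VB].
pose v := V k x.
have vK0 : 0 <= v * K.+1%:R by rewrite mulr_ge0// V_ge0.
have /andP[mv vm] := truncn_itv vK0.
move: mv vm; case Em : (Num.truncn (v * K.+1%:R)) => [|[|i]] mv vm.
1,2: exfalso; have : a * K.+1%:R <= v * K.+1%:R by rewrite ler_wpM2r.
1,2: have : K.+1%:R * (a * (1 - l)) <= K.+1%:R * a.
1,3: by rewrite ler_wpM2l// ler_piMr//; lra.
1,2: by move: vm; set K1 := K.+1%:R in hK *; lra.
have iE : i.+2%:R = i%:R + 2 :> R by rewrite -natrD addn2.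
have iE1 : i.+1%:R = i%:R + 1 :> R by rewrite natr1.
have iE3 : i.+3%:R = i%:R + 3 :> R by rewrite -natrD addn3.
have aK : a * K.+1%:R <= v * K.+1%:R by rewrite ler_wpM2r.
have Vl2 : 2 <= i.+2%:R * (1 - l).
  have : a * K.+1%:R * (1 - l) <= i.+3%:R * (1 - l).
    by rewrite ler_wpM2r ?subr_ge0 ?(ltW l1)// (le_trans aK)// ltW.
  move: hK; rewrite iE iE3; have : (1 - l) * 1 <= 1 by lra.
  set K1 := K.+1%:R; set i1 := i%:R; nra.
exists i; rewrite /grid_pair/=; split.
- rewrite ltnS; apply: leq_trans (_ : i.+2 <= _)%N; first by rewrite -addn2 leq_addr.
  rewrite -Em; apply: le_truncn; exact: ler_wpM2r.
- split; first by rewrite divr_gt0//= ltr_pM2r ?invr_gt0// ltr_nat.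
  move=> k' x' Vx'; have [Va|Va] := ltP (V k' x') (a / 2).
    apply: le_trans (V_noninc k' x') _; apply: le_trans (ltW Va) _.
    rewrite ler_pdivlMr//; move: hK aK vm; rewrite iE1 iE3.
    have : K.+1%:R * (a * (1 - l)) <= K.+1%:R * a.
      by rewrite ler_wpM2l// ler_piMr//; lra.
    set K1 := K.+1%:R; set i1 := i%:R; lra.
  have Vv : V k' x' <= v.
    by apply/ltW/(lt_le_trans Vx'); rewrite ler_pdivrMr.
  apply: le_trans (Vl k' x' _) _; first by rewrite Va (le_trans Vv).
  apply: (@le_trans _ _ (l * (i.+2%:R / K.+1%:R))).
    by rewrite ler_pM2l// ltW.
  by rewrite mulrA ler_pM2r ?invr_gt0//; move: Vl2; rewrite iE iE1; lra.
- by rewrite ler_pdivrMr.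
- apply: le_trans (Vl k x _) _; first by rewrite VB andbT; lra.
  rewrite -/v ler_pdivlMr// -mulrA.
  apply: (@le_trans _ _ (l * i.+3%:R)); first by rewrite ler_pM2l// ltW.
  by move: Vl2; rewrite iE iE1 iE3; lra.
Qed.

Lemma smooth_gap_step p q k : gap p q ->
  exists theta : E -> R, [/\ smooth theta, forall x, 0 <= theta x <= 1,
    forall x, V k x <= p -> theta x = 0 & forall x, q <= V k x -> theta x = 1].
Proof.
move=> [/andP[p0 pq] _]; have q0 := lt_trans p0 pq.
have [x|t [st t01 t0 t1]] := smooth_urysohn
  (V_gt_open (k := k) p0) (V_lt_open (k := k) q0).
  by have [xp|xp] := ltP p (V k x); [left|right; exact: le_lt_trans pq].
exists t; split => // x xpq; [apply: t0|apply: t1];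
  by apply/negP; rewrite -leNgt.
Qed.

Lemma gap_enumeration : exists pq : nat -> R * R,
  [/\ forall i, gap (pq i).1 (pq i).2,
      forall i, odd i -> (pq i).1 = i.+1%:R &
      forall iK, gap (grid_pair iK).1 (grid_pair iK).2 ->
        pq (pickle iK).*2 = grid_pair iK].
Proof.
suff /choice[pq Hpq] : forall i, exists pq : R * R, [/\ gap pq.1 pq.2,
    odd i -> pq.1 = i.+1%:R &
    forall iK, i = (pickle iK).*2 -> gap (grid_pair iK).1 (grid_pair iK).2 ->
      pq = grid_pair iK].
  exists pq; split => [i|i|iK]; [by case: (Hpq i)|by case: (Hpq i)|].
  by have [_ _] := Hpq (pickle iK).*2; exact.
move=> i; have [oi|ei] := boolP (odd i).
  have [q gq] := @gap_above i.+1%:R (ltr0Sn _ _).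
  by exists (i.+1%:R, q); split => // iK iE; move: oi; rewrite iE odd_double.
have [[iK [iE giK]]|niK] := pselect (exists iK, i = (pickle iK).*2 /\
    gap (grid_pair iK).1 (grid_pair iK).2).
  exists (grid_pair iK); split => // jK; rewrite iE.
  by move=> /double_inj/(pcan_inj pickleK) ->.
have [q gq] := @gap_above 1 ltr01.
exists (1, q); split => // iK iE giK.
by exfalso; apply: niK; exists iK.
Qed.

Lemma smooth_lyapunov : exists W : int -> E -> R,
  [/\ forall k, smooth (W k),
      forall k x, 0 <= W k x <= 3 * V k x,
      forall a, 0 < a -> exists2 e, 0 < e & forall k x, a <= V k x -> e <= W k x,
      forall M, exists B, forall k x, B <= V k x -> M <= W k x &
      (forall k x, W (k + 1) (F k x) <= W k x) /\
      forall a B, 0 < a -> exists2 e, 0 < e &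
        forall k x, a <= V k x <= B -> W (k + 1) (F k x) <= W k x - e].
Proof.
have [pq [gpq pq_odd pq_grid]] := gap_enumeration.
pose p i := (pq i).1; pose q i := (pq i).2.
have p0 i : 0 < p i by have [/andP[]] := gpq i.
have /choice[th Hth] : forall ik : nat * int, exists theta : E -> R,
    [/\ smooth theta, forall x, 0 <= theta x <= 1,
    forall x, V ik.2 x <= p ik.1 -> theta x = 0 &
    forall x, q ik.1 <= V ik.2 x -> theta x = 1].
  by move=> [i k]; exact: smooth_gap_step (gpq i).
have sth i k : smooth (th (i, k)) by case: (Hth (i, k)).
have th0 i k x : 0 <= th (i, k) x by have [_ /(_ x)/andP[]] := Hth (i, k).
have th1 i k x : th (i, k) x <= 1 by have [_ /(_ x)/andP[]] := Hth (i, k).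
have thp i k x : V k x <= p i -> th (i, k) x = 0.
  by have [_ _ /(_ x)] := Hth (i, k).
have thq i k x : q i <= V k x -> th (i, k) x = 1.
  by have [_ _ _ /(_ x)] := Hth (i, k).
have th_noninc i k x : th (i, k + 1) (F k x) <= th (i, k) x.
  have [/thq ->//|/((gpq i).2)/thp ->//] := leP (q i) (V k x).
pose int_of n : int := odflt 0 (unpickle n).
have [c [c0 cth]] := @fast_coef R N (fun i n => th (i, int_of n))
  (fun i n => sth i (int_of n)).
pose C i := if i.+1%:R <= p i then 1 else Num.min (c i) (2^-1 ^+ i * p i).
have C0 i : 0 < C i.
  by rewrite /C; case: ifP => // _; rewrite lt_min c0 mulr_gt0// exprn_gt0// invr_gt0.
have C_sum l : l%:R <= \sum_(0 <= i < l.*2) C i.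
  elim: l => [|l IHl]; first by rewrite big_geq.
  rewrite doubleS !big_nat_recr//= -natr1.
  apply: lerD; first by apply: le_trans IHl _; rewrite lerDl ltW.
  by rewrite /C /p pq_odd ?lexx//= odd_double.
pose h k i x := C i * th (i, k) x.
have h0 k i x : 0 <= h k i x by rewrite mulr_ge0// ltW.
have fh k m : fast_near m (h k).
  pose h' i : E -> R := if i.+1%:R <= p i then fun=> 0 else h k i.
  have fh' : fast_near m h'.
    apply: (@fast_near_ball _ _ _ _ (pickle k)) => i ki; rewrite /h'.
    case: ifPn => ip.
      by apply: dbound_eq0 => //; exact: ball_open.
    have := cth i (pickle k) (C i) ki; rewrite /int_of pickleK/=; apply.
    by rewrite ltW ?C0//= /C (negPf ip) ge_min lexx.
  move=> x0; have [r r0 [I hI]] := fh' x0.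
  have B0 : 0 < V k x0 + 1 by rewrite ltr_pwDr.
  have /nbhs_ballP[r1 /= r10 rV] : nbhs x0 [set x | V k x < V k x0 + 1].
    apply: open_nbhs_nbhs; split; first exact: V_lt_open.
    by rewrite /= ltrDl.
  exists (Num.min r r1); first by rewrite lt_min r0.
  exists (maxn I (Num.truncn (V k x0 + 1))) => i; rewrite geq_max => /andP[Ii Bi].
  have [ip|ip] := boolP (i.+1%:R <= p i).
    apply: dbound_eq0 => [|//|]; first exact: ball_open.
    move=> x xr; rewrite /h thp ?mulr0//.
    have /rV/= Vx : ball x0 r1 x by apply: le_ball xr; rewrite ge_min lexx orbT.
    apply: le_trans (ltW Vx) _; apply: le_trans ip.
    by apply/ltW/(lt_le_trans (truncnS_gt _)); rewrite ler_nat ltnS.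
  have := hI i Ii; rewrite /h' (negPf ip); apply: dbound_leq => //.
  by apply: le_ball; rewrite ge_min lexx.
have ch k x : cvgn (series ((h k) ^~ x)) by exact: fast_near_cvg (fh k 0%N).
pose W k := fsum (h k).
have W_ge k x n : \sum_(0 <= i < n) h k i x <= W k x by exact: fsum_ge_partial.
have W0 k x : 0 <= W k x by apply: le_trans (W_ge k x 0%N); rewrite big_geq.
have W_dec k x i : h k i x - h (k + 1) i (F k x) <= W k x - W (k + 1) (F k x).
  have d0 j : 0 <= h k j x - h (k + 1) j (F k x).
    by rewrite -mulrBr mulr_ge0 ?subr_ge0// ltW.
  have -> : W k x - W (k + 1) (F k x) =
      fsum (fun j (_ : E) => h k j x - h (k + 1) j (F k x)) x.
    by rewrite /W /fsum -lim_seriesB.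
  apply: le_trans (fsum_ge_partial i.+1 d0 _); last first.
    exact: is_cvg_seriesB (ch k x) (ch (k + 1) (F k x)).
  by rewrite big_nat_recr//= lerDr sumr_ge0.
have W_noninc k x : W (k + 1) (F k x) <= W k x.
  rewrite -subr_ge0; apply: le_trans (W_dec k x 0%N).
  by rewrite -mulrBr mulr_ge0 ?subr_ge0// ltW.
have W_gap a B : 0 < a -> exists2 e, 0 < e &
    forall k x, a <= V k x <= B -> W (k + 1) (F k x) <= W k x - e.
  move=> a0; have [K [I HI]] := gap_grid B a0.
  have [e e0 eC] := @finite_pos_min R (fun j => C (pickle (j, K)).*2) I
    (fun j => C0 _).
  exists e => // k x /HI[i [iI gi qi pi]].
  have pqE := pq_grid _ gi.
  rewrite lerBrDl -lerBrDr; apply: le_trans (eC _ iI) _.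
  apply: le_trans (W_dec k x (pickle (i, K)).*2).
  by rewrite /h thq ?thp /q /p ?pqE// mulr1 mulr0 subr0.
have W_unbounded M : exists B, forall k x, B <= V k x -> M <= W k x.
  pose l := (Num.truncn M).+1.
  exists (\sum_(0 <= i < l.*2) q i) => k x qV.
  apply/ltW/(lt_le_trans (truncnS_gt M)); apply: le_trans (W_ge k x l.*2).
  have -> : \sum_(0 <= i < l.*2) h k i x = \sum_(0 <= i < l.*2) C i.
    rewrite big_nat_cond [RHS]big_nat_cond; apply: eq_bigr => i.
    rewrite andbT /= => il; rewrite /h thq ?mulr1//; apply: le_trans qV.
    rewrite big_mkord (bigD1 (Ordinal il))//= lerDl sumr_ge0// => j _.
    by have [/andP[pj0 pqj] _] := gpq j; rewrite ltW// (lt_trans pj0).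
  exact: C_sum.
exists W; split => //.
- move=> k m; apply: fsum_td => // i; apply: tdZ; exact: sth.
- move=> k x; rewrite W0/=; apply: fsum_le => // n.
  apply: (@le_trans _ _ (\sum_(0 <= i < n)
      ((i.+1%:R <= V k x)%R%:R + 2^-1 ^+ i * V k x))).
    apply: ler_sum => i _; rewrite /h.
    have i0 : 0 <= 2^-1 ^+ i * V k x by rewrite mulr_ge0// exprn_ge0// invr_ge0.
    have [Vp|pV] := leP (V k x) (p i); first by rewrite thp// mulr0 addr_ge0.
    apply: (@le_trans _ _ (C i)); first by rewrite ler_piMr// ltW.
    rewrite /C; case: ifPn => ip.
      by rewrite (le_trans ip (ltW pV)) lerDl.
    rewrite ge_min; apply/orP; right; apply: ler_wpDl => //.
    by rewrite ler_wpM2l ?ltW// exprn_ge0// invr_ge0.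
  rewrite big_split/= -mulr_suml.
  have := @sum_indic_le R (V k x) n (V_ge0 k x).
  have := half_pow_sum_le R 0 n; rewrite add0n expr0 mul1r => H1 H2.
  have := ler_wpM2r (V_ge0 k x) H1; lra.
- move=> a a0; have [B HB] := W_unbounded 1.
  have [e e0 We] := W_gap a B a0.
  exists (Num.min e 1) => [|k x aV]; first by rewrite lt_min e0 ltr01.
  have [BV|/ltW VB] := leP B (V k x); first by rewrite ge_min HB// orbT.
  rewrite ge_min; apply/orP; left.
  have := We k x; rewrite aV VB => /(_ isT).
  by have := W0 (k + 1) (F k x); lra.
Qed.

End SmoothLyapunov.

(** * The nonsmooth Lyapunov function *)

Lemma sup_nat_ge (R : realType) (u : nat -> R) c j :
  (forall i, u i <= c) -> u j <= sup (range u).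
Proof. by move=> uc; apply: ub_le_sup; [exists c => _ [i _ <-]|exists j]. Qed.

Lemma sup_nat_le (R : realType) (u : nat -> R) c :
  (forall i, u i <= c) -> sup (range u) <= c.
Proof. by move=> uc; apply: ge_sup => [|_ [i _ <-]//]; exists (u 0%N), 0%N. Qed.

Section ClassKL.
Variables (R : realType) (b : R -> R -> R).
Hypothesis bKL : class_KL b.

Lemma KL0 t : 0 <= t -> b 0 t = 0.
Proof. by case: bKL => + _ => /[apply] -[]. Qed.

Lemma KL_le_l s1 s2 t : 0 <= t -> 0 <= s1 <= s2 -> b s1 t <= b s2 t.
Proof.
move=> t0 /andP[s10]; rewrite le_eqVlt => /predU1P[->//|s12].
have [_ _ incr] := bKL.1 t t0; apply/ltW/incr => //.
  by rewrite in_itv/= s10.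
by rewrite in_itv/= (le_trans s10 (ltW s12)).
Qed.

Lemma KL_ge0 s t : 0 <= s -> 0 <= t -> 0 <= b s t.
Proof. by move=> s0 t0; rewrite -(KL0 t0) KL_le_l// lexx. Qed.

Lemma KL_le_r s t1 t2 : 0 <= s -> 0 <= t1 <= t2 -> b s t2 <= b s t1.
Proof.
rewrite le_eqVlt => /predU1P[<-|s0] /andP[t10 t12].
  by rewrite !KL0// (le_trans t10).
move: t12; rewrite le_eqVlt => /predU1P[->//|t12].
have [_ decr _] := bKL.2 s s0; apply/ltW/decr => //.
  by rewrite in_itv/= (le_trans t10 (ltW t12)).
by rewrite in_itv/= t10.
Qed.

Lemma KL_small s e : 0 <= s -> 0 < e ->
  exists T : nat, forall j, (T <= j)%N -> b s j%:R <= e.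
Proof.
rewrite le_eqVlt => /predU1P[<-|s0] e0.
  by exists 0%N => j _; rewrite KL0// ltW.
have [_ _ bs0] := bKL.2 s s0.
have [M [_ HM]] : \forall t \near +oo, `|b s t| <= e by exact: cvgr0_norm_le bs0 e e0.
exists (Num.truncn M).+1 => j Mj; apply: (le_trans (ler_norm _)); apply: HM.
by apply: (lt_le_trans (truncnS_gt M)); rewrite ler_nat.
Qed.

End ClassKL.

Section WeightedSup.
Variables (R : realType) (E : topologicalType) (D : int -> E -> nat -> R).
Variables (F : int -> E -> E) (b : R -> R -> R).
Hypothesis bKL : class_KL b.
Hypothesis D_ge0 : forall k z j, 0 <= D k z j.
Hypothesis D_cont : forall k j, continuous (fun z => D k z j).
Hypothesis D_step : forall k z j, D (k + 1) (F k z) j = D k z j.+1.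
Hypothesis D_le : forall k z j, D k z j <= b (D k z 0%N) j%:R.

Definition weight (j : nat) : R := 2 - j.+1%:R^-1.

Lemma weight_ge1 j : 1 <= weight j.
Proof.
rewrite /weight; have : j.+1%:R^-1 <= 1 :> R by rewrite invf_le1// ler1n.
set u := _^-1; lra.
Qed.

Lemma weight_le2 j : weight j <= 2.
Proof. by rewrite /weight gerBl. Qed.

Lemma weight_succ j : weight j <= weight j.+1.
Proof. by rewrite /weight lerB// lef_pV2 ?posrE// ler_nat. Qed.

Definition weighted_sup k z : R := sup (range (fun j => weight j * D k z j)).
Local Notation V := weighted_sup.

Lemma term_le k z j : weight j * D k z j <= 2 * b (D k z 0%N) j%:R.
Proof. by apply: ler_pM; rewrite ?weight_le2// (le_trans ler01)// weight_ge1. Qed.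

Lemma term_le0 k z j : weight j * D k z j <= 2 * b (D k z 0%N) 0.
Proof.
apply: (le_trans (term_le k z j)); rewrite ler_pM2l//.
by apply: (KL_le_r bKL) => //; rewrite lexx/=.
Qed.

Lemma weighted_sup_ge k z j : weight j * D k z j <= V k z.
Proof. by apply: sup_nat_ge (term_le0 k z). Qed.

Lemma weighted_sup_le k z : V k z <= 2 * b (D k z 0%N) 0.
Proof. exact: sup_nat_le (term_le0 k z). Qed.

Lemma weighted_sup_ge0th k z : D k z 0%N <= V k z.
Proof.
apply: le_trans (weighted_sup_ge k z 0); rewrite ler_peMl//; exact: weight_ge1.
Qed.

Lemma weighted_sup_noninc k z : V (k + 1) (F k z) <= V k z.
Proof.
apply: sup_nat_le => j; rewrite D_step.
apply: le_trans (weighted_sup_ge k z j.+1).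
by rewrite ler_wpM2r// weight_succ.
Qed.

Lemma weighted_sup_gt_open k c : open [set z | c < V k z].
Proof.
rewrite openE => z /= cV.
have [j cj] : exists j, c < weight j * D k z j.
  apply: contrapT => nj; move: cV; apply/negP; rewrite -leNgt.
  apply: sup_nat_le => j; rewrite leNgt; apply/negP => cj.
  by apply: nj; exists j.
have /cvgrPdist_lt/(_ (weight j * D k z j - c)) : weight j * D k y j @[y --> z]
    --> weight j * D k z j.
  by apply: cvgM; [exact: cvg_cst|exact: D_cont].
rewrite subr_gt0 => /(_ cj); apply: filterS => y /= yz.
apply: lt_le_trans (weighted_sup_ge k y j).
by have := le_lt_trans (ler_norm _) yz; lra.
Qed.

(* The tail of the supremum is uniformly small near a point, so locally only
   finitely many continuous terms matter. *)
Lemma weighted_sup_lt_open k c : 0 < c -> open [set z | V k z < c].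
Proof.
move=> c0; rewrite openE => z /= Vc.
have B0 : 0 <= D k z 0%N + 1 by rewrite addr_ge0.
have [T HT] := @KL_small _ _ bKL _ (c / 4) B0 ltac:(by rewrite divr_gt0).
pose c' := Num.max ((V k z + c) / 2) (c / 2).
have c'c : c' < c by rewrite gt_max; apply/andP; split; lra.
have nB : \forall y \near z, D k y 0%N <= D k z 0%N + 1.
  have /cvgrPdist_le/(_ 1 ltr01) := @D_cont k 0%N z; apply: filterS => y /=.
  by rewrite distrC => /(le_trans (ler_norm _)); lra.
have nT : \forall y \near z, forall j : 'I_T, weight j * D k y j <= c'.
  apply: filter_forall => j.
  have : weight j * D k y j @[y --> z] --> weight j * D k z j.
    by apply: cvgM; [exact: cvg_cst|exact: D_cont].
  move=> /cvgrPdist_le/(_ (c' - V k z)) H.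
  have c'V : 0 < c' - V k z.
    by rewrite subr_gt0 lt_max; apply/orP; left; lra.
  move: (H c'V); apply: filterS => y /=; rewrite distrC => /(le_trans (ler_norm _)).
  have := weighted_sup_ge k z j; lra.
near=> y; apply: le_lt_trans c'c; apply: sup_nat_le => j.
have [jT|Tj] := ltnP j T.
  have yT : forall i : 'I_T, weight i * D k y i <= c' by near: y; exact: nT.
  exact: (yT (Ordinal jT)).
apply: (le_trans (term_le k y j)).
rewrite le_max; apply/orP; right.
have yB : D k y 0%N <= D k z 0%N + 1 by near: y; exact: nB.
have : b (D k y 0%N) j%:R <= b (D k z 0%N + 1) j%:R.
  by apply: (KL_le_l bKL) => //; rewrite D_ge0.
by have := HT j Tj; lra.
Unshelve. all: by end_near. Qed.

Lemma weighted_sup_decay a B : 0 < a -> exists2 l : R, 2^-1 <= l < 1 &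
  forall k z, a <= V k z <= B -> V (k + 1) (F k z) <= l * V k z.
Proof.
move=> a0; have [B0|B0] := leP 0 B; last first.
  exists 2^-1 => [|k z /andP[aV VB]]; first by rewrite lexx/= invf_lt1// ltr1n.
  by exfalso; lra.
have [T HT] := @KL_small _ _ bKL _ (a / 4) B0 ltac:(by rewrite divr_gt0).
pose e : R := (T.+1%:R * T.+2%:R)^-1 / 2.
have T0 : 1 <= T.+1%:R :> R by rewrite ler1n.
have T1 : 1 <= T.+2%:R :> R by rewrite ler1n.
have e0 : 0 < e by rewrite divr_gt0// invr_gt0 mulr_gt0//; lra.
have e1 : e <= 2^-1.
  rewrite /e ler_piMl// invf_le1 ?mulr_ege1// mulr_gt0//; lra.
exists (1 - e) => [|k z /andP[aV VB]]; first by apply/andP; split; lra.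
have V0 : 0 <= V k z by apply: le_trans aV; exact: ltW.
apply: sup_nat_le => j; rewrite D_step.
have [jT|Tj] := ltnP j T; last first.
  apply: (@le_trans _ _ (2 * (a / 4))).
    apply: ler_pM => //; first by rewrite (le_trans ler01)// weight_ge1.
      exact: weight_le2.
    apply: le_trans (HT j.+1 (leqW Tj)); apply: (le_trans (D_le k z _)).
    apply: (KL_le_l bKL) => //; rewrite D_ge0/=.
    exact: le_trans (weighted_sup_ge0th k z) VB.
  have : 2^-1 * V k z <= (1 - e) * V k z by rewrite ler_wpM2r//; lra.
  lra.
have wj : weight j <= (1 - e) * weight j.+1.
  have we : e * weight j.+1 <= e * 2 by rewrite ler_pM2l// weight_le2.
  have wS : weight j.+1 - weight j = (j.+1%:R * j.+2%:R)^-1.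
    rewrite /weight -[j.+2%:R]natr1; set u := j.+1%:R.
    have u0 : 1 <= u by rewrite ler1n.
    by field; apply/andP; split; lra.
  have : e * 2 <= weight j.+1 - weight j.
    rewrite wS /e divfK// lef_pV2 ?posrE ?mulr_gt0//.
    by rewrite ler_pM// ler_nat// ltnW.
  move: we; rewrite mulrBl mul1r; set ew := e * weight _; lra.
apply: (@le_trans _ _ ((1 - e) * weight j.+1 * D k z j.+1)).
  by rewrite ler_wpM2r.
by rewrite -mulrA ler_wpM2l ?weighted_sup_ge//; lra.
Qed.

End WeightedSup.

(** * Comparison functions and the converse theorem *)

Lemma lipschitz_continuous (R : realType) (u : R -> R) (c : R) :
  (forall r r', u r <= u r' + c * `|r - r'|) -> continuous u.
Proof.
move=> ul r; apply/cvgrPdist_le => e e0.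
have c1 : 0 < `|c| + 1 by rewrite ltr_wpDl.
near=> r'.
have rr' : `|r - r'| <= e / (`|c| + 1).
  by near: r'; apply: cvgr_dist_le => //; rewrite divr_gt0.
have cr : c * `|r - r'| <= e.
  apply: (@le_trans _ _ ((`|c| + 1) * `|r - r'|)).
    by rewrite ler_wpM2r// (le_trans (ler_norm c))// lerDl.
  by rewrite mulrC -ler_pdivlMr.
rewrite ler_distlC; have := ul r r'; have := ul r' r; rewrite distrC.
by move=> H1 H2; apply/andP; split; lra.
Unshelve. all: by end_near. Qed.

Section InfConvolution.
Variables (R : realType) (T : Type) (s y : T -> R) (pen : R -> R).
Hypothesis y_ge0 : forall t, 0 <= y t.
Hypothesis pen_ge0 : forall r, 0 <= pen r.
Hypothesis pen0 : pen 0 = 0.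
Hypothesis pen_lip : forall r r', pen r <= pen r' + `|r - r'|.

(* [None] stands for the additional point (0, 0), which forces the value 0 at
   0. *)
Definition infconv_term (r : R) (o : option T) : R :=
  if o is Some t then y t + pen (r - s t) else pen r.

Definition infconv (r : R) : R := inf (range (infconv_term r)).

Let term_ge0 r o : 0 <= infconv_term r o.
Proof. by case: o => [t|]//=; rewrite addr_ge0. Qed.

Lemma infconv_le_term r o : infconv r <= infconv_term r o.
Proof. by apply: ge_inf; [exists 0 => _ [p _ <-]|exists o]. Qed.

Lemma infconv_ge r c : (forall o, c <= infconv_term r o) -> c <= infconv r.
Proof.
move=> cr; apply: lb_le_inf; first by exists (pen r), None.
by move=> _ [p _ <-]; exact: cr.
Qed.

Lemma infconv_ge0 r : 0 <= infconv r.
Proof. by apply: infconv_ge => o; exact: term_ge0. Qed.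

Lemma infconv_0 : infconv 0 = 0.
Proof.
apply/eqP; rewrite eq_le infconv_ge0 andbT.
by apply: le_trans (infconv_le_term 0 None) _; rewrite /= pen0.
Qed.

Lemma infconv_le t : infconv (s t) <= y t.
Proof.
by apply: le_trans (infconv_le_term _ (Some t)) _; rewrite /= subrr pen0 addr0.
Qed.

Lemma infconv_continuous : continuous infconv.
Proof.
apply: (@lipschitz_continuous _ _ 1) => r r'; rewrite mul1r -lerBlDr.
apply: infconv_ge => o; rewrite lerBlDr; apply: (le_trans (infconv_le_term r o)).
case: o => [t|] /=; last exact: pen_lip.
rewrite -addrA lerD2l; apply: (le_trans (pen_lip _ (r' - s t))).
by rewrite opprB addrA subrK.
Qed.

End InfConvolution.

Lemma pd_minorant (R : realType) (T : Type) (s y : T -> R) :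
  (forall t, 0 <= y t) ->
  (forall a B, 0 < a -> exists2 e, 0 < e & forall t, a <= s t <= B -> e <= y t) ->
  exists2 al : R -> R, positive_definite al & forall t, al (s t) <= y t.
Proof.
move=> y0 ye; pose pen (r : R) := `|r|.
have pen0 : pen 0 = 0 by exact: normr0.
have pen_ge0 r : 0 <= pen r by exact: normr_ge0.
have pen_lip r r' : pen r <= pen r' + `|r - r'|.
  by rewrite /pen -{1}(subrK r' r) addrC ler_normD.
exists (infconv s y pen); last by move=> t; exact: infconv_le.
split => [||r r0].
- by apply: continuous_subspaceT; exact: infconv_continuous.
- exact: infconv_0.
have [e e0 He] := ye (r / 2) (2 * r) ltac:(by rewrite divr_gt0).
apply: (@lt_le_trans _ _ (Num.min e (r / 2))); first by rewrite lt_min e0 divr_gt0.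
apply: infconv_ge => -[t|] /=; last first.
  by rewrite ge_min /pen (gtr0_norm r0); apply/orP; right; lra.
have [sr|sr] := boolP (r / 2 <= s t <= 2 * r).
  by rewrite ge_min; apply/orP; left; rewrite (le_trans (He t sr))// lerDl.
rewrite ge_min; apply/orP; right; have := y0 t.
move: sr; rewrite negb_and -!ltNge => /orP[] sr.
  by have := ler_norm (r - s t); rewrite /pen; lra.
by have := ler_norm (- (r - s t)); rewrite normrN /pen; lra.
Qed.

Lemma Kinf_minorant (R : realType) (T : Type) (s y : T -> R) :
  (forall t, 0 <= s t) -> (forall t, 0 <= y t) ->
  (forall a, 0 < a -> exists2 e, 0 < e & forall t, a <= s t -> e <= y t) ->
  (forall M, exists B, forall t, B <= s t -> M <= y t) ->
  exists2 al : R -> R, class_Kinf al & forall t, al (s t) <= y t.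
Proof.
move=> s0 y0 ye yM; pose pen (r : R) := Num.max 0 r.
have pen0 : pen 0 = 0 by rewrite /pen maxxx.
have pen_ge0 r : 0 <= pen r by rewrite le_max lexx.
have pen_ge r : r <= pen r by rewrite le_max lexx orbT.
have pen_lip r r' : pen r <= pen r' + `|r - r'|.
  rewrite ge_max addr_ge0//=; have := ler_norm (r - r'); have := pen_ge r'; lra.
pose u := infconv s y pen; pose g (r : R) := r / (1 + `|r|).
have u0 r : 0 <= u r by exact: infconv_ge0.
have u_incr r r' : r <= r' -> u r <= u r'.
  move=> rr'; apply: infconv_ge => o; apply: (le_trans (infconv_le_term s y0 pen_ge0 r o)).
  case: o => [t|] /=; rewrite ?lerD2l /pen ge_max le_max lexx/= le_max.
    by rewrite lerD2r rr' orbT.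
  by rewrite rr' orbT.
have u_gt0 r : 0 < r -> 0 < u r.
  move=> r0; have [e e0 He] := ye (r / 2) ltac:(by rewrite divr_gt0).
  apply: (@lt_le_trans _ _ (Num.min e (r / 2))); first by rewrite lt_min e0 divr_gt0.
  apply: infconv_ge => -[t|] /=; rewrite ge_min; last first.
    by apply/orP; right; have := pen_ge r; lra.
  have [sr|sr] := leP (r / 2) (s t).
    by apply/orP; left; rewrite (le_trans (He t sr))// lerDl.
  by apply/orP; right; have := pen_ge (r - s t); have := y0 t; lra.
have u_infty M : exists2 r, 1 <= r & M <= u r.
  have [B HB] := yM M; exists (1 + `|B| + `|M|) => [|].
    by rewrite -addrA lerDl addr_ge0.
  apply: infconv_ge => -[t|] /=.
    have [/HB Mt|sB] := leP B (s t); first by rewrite (le_trans Mt)// lerDl.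
    have := pen_ge (1 + `|B| + `|M| - s t); have := y0 t.
    by have := ler_norm B; have := ler_norm M; lra.
  apply: le_trans (pen_ge _); have := ler_norm M; have := normr_ge0 B; lra.
have g_ge0 r : 0 <= r -> 0 <= g r by move=> r0; rewrite divr_ge0// addr_ge0.
have g_incr r r' : 0 <= r -> r < r' -> g r < g r'.
  move=> r0 rr'; have r'0 := le_lt_trans r0 rr'.
  rewrite /g (ger0_norm r0) (gtr0_norm r'0).
  rewrite ltr_pdivrMr ?ltr_wpDr// mulrAC ltr_pdivlMr ?ltr_wpDr ?(ltW r'0)//.
  by rewrite !mulrDr !mulr1 mulrC ltrD2r.
have g_le1 r : 0 <= r -> g r <= 1.
  by move=> r0; rewrite /g ler_pdivrMr ?ltr_wpDr// (ger0_norm r0) mul1r lerDr.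
exists (fun r => u r * g r); last first.
  move=> t; apply: (@le_trans _ _ (u (s t))); last exact: infconv_le.
  by rewrite ler_piMr ?g_le1.
split; first split => [||r r'].
- apply: continuous_subspaceT => r; apply: cvgM; first exact: infconv_continuous.
  apply: cvgM => //; apply: cvgV; first by rewrite gt_eqF// ltr_wpDr.
  by apply: cvgD; [exact: cvg_cst|apply: cvg_norm].
- by rewrite /u infconv_0// mul0r.
- rewrite !in_itv/= !andbT => r0 _ rr'; have r'0 := le_lt_trans r0 rr'.
  apply: (@le_lt_trans _ _ (u r' * g r)).
    by rewrite ler_wpM2r ?g_ge0// u_incr// ltW.
  by rewrite ltr_pM2l ?u_gt0// g_incr.
move=> M; have [r r1 Mr] := u_infty (2 * (`|M| + 1)).
have r0 : 0 <= r by exact: le_trans r1.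
exists r => //; apply: (@lt_le_trans _ _ (2 * (`|M| + 1) * g r)); last first.
  by rewrite ler_wpM2r ?g_ge0.
have g2 : 2^-1 <= g r.
  by rewrite /g ler_pdivlMr ?ltr_wpDr// (ger0_norm r0); lra.
apply: (@lt_le_trans _ _ (2 * (`|M| + 1) * 2^-1)).
  by have := ler_norm M; lra.
by rewrite ler_wpM2l// mulr_ge0// addr_ge0.
Qed.

Section Enorm.
Variables (R : realType) (n : nat).
Implicit Types x : 'rV[R]_n.

Lemma enorm_ge0 x : 0 <= enorm x.
Proof. exact: sqrtr_ge0. Qed.

Lemma enorm_continuous : continuous (@enorm R n).
Proof.
move=> x; apply: (@continuous_comp _ _ _ (fun x => \sum_(i < n) x 0 i ^+ 2) Num.sqrt).
  apply: (@continuous_sum R 'rV[R]_n _ _ (fun i (x : 'rV[R]_n) => x 0 i ^+ 2)).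
  move=> i z; apply: (@continuous_comp _ _ _ (fun z : 'rV[R]_n => z 0 i) (fun t => t ^+ 2)).
    exact: coord_continuous.
  exact: exprn_continuous.
exact: sqrt_continuous.
Qed.

End Enorm.

Section Converse.
Variables (R : realType) (n : nat) (f : int -> 'rV[R]_n -> 'rV[R]_n).
Hypothesis f_cont : forall k, continuous (f k).

Lemma phi_steps_continuous k j : continuous (fun x => phi_steps f k x j).
Proof.
elim: j => [|j IHj] x /=; first exact: cvg_id.
by apply: (continuous_comp (IHj x)); exact: f_cont.
Qed.

Lemma phi_steps_step k x j :
  phi_steps f (k + 1) (f k x) j = phi_steps f k x j.+1.
Proof.
elim: j => [|j IHj] /=; first by rewrite addr0.
by rewrite IHj /= -addrA -PoszD add1n.
Qed.

Lemma phi_phi_steps k x j : phi f (k + j%:Z) k x = phi_steps f k x j.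
Proof. by rewrite /phi addrC addKr. Qed.

Lemma stable_lyapunov : incrementally_stable f ->
  exists (V : int -> 'rV[R]_n -> 'rV[R]_n -> R) (a1 a2 a3 : R -> R),
    [/\ forall k x1 x2, 0 <= V k x1 x2,
        forall k, smooth (fun p : 'rV[R]_n * 'rV[R]_n => V k p.1 p.2),
        class_Kinf a1 /\ class_Kinf a2,
        positive_definite a3 &
        forall (x1 x2 : 'rV[R]_n) (k : int),
          [/\ a1 (enorm (x1 - x2)) <= V k x1 x2,
              V k x1 x2 <= a2 (enorm (x1 - x2)) &
              V (k + 1) (f k x1) (f k x2) - V k x1 x2
                <= - a3 (enorm (x1 - x2))]].
Proof.
move=> [b [bKL fb]].
pose E := 'rV[R]_(n + n).
pose D k (z : E) j :=
  enorm (phi_steps f k (lsubmx z) j - phi_steps f k (rsubmx z) j).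
pose F k (z : E) : E := row_mx (f k (lsubmx z)) (f k (rsubmx z)).
have D_ge0 k z j : 0 <= D k z j by exact: enorm_ge0.
have D_cont k j : continuous (fun z => D k z j).
  have cl : continuous (fun z : E => phi_steps f k (lsubmx z) j).
    move=> z; apply: (@continuous_comp E _ _ lsubmx (fun x => phi_steps f k x j)).
      exact/differentiable_continuous/differentiable_lsubmx.
    exact: phi_steps_continuous.
  have cr : continuous (fun z : E => phi_steps f k (rsubmx z) j).
    move=> z; apply: (@continuous_comp E _ _ rsubmx (fun x => phi_steps f k x j)).
      exact/differentiable_continuous/differentiable_rsubmx.
    exact: phi_steps_continuous.
  move=> z; apply: (continuous_comp (cvgB (cl z) (cr z))).
  exact: enorm_continuous.
have D_step k z j : D (k + 1) (F k z) j = D k z j.+1.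
  by rewrite /D /F row_mxKl row_mxKr !phi_steps_step.
have D_le k z j : D k z j <= b (D k z 0%N) j%:R.
  have := fb (lsubmx z) (rsubmx z) (k + j%:Z) k.
  by rewrite lerDl addrAC subrr add0r !phi_phi_steps; apply.
pose V0 := weighted_sup D.
have V0_ge k z : D k z 0%N <= V0 k z := weighted_sup_ge0th bKL D_ge0 D_le k z.
have V0_ge0 k z : 0 <= V0 k z by exact: le_trans (V0_ge k z).
have V0_le k z : V0 k z <= 2 * b (D k z 0%N) 0 := weighted_sup_le bKL D_ge0 D_le k z.
have [W [sW W_bnd W_pos W_infty [W_noninc W_dec]]] := @smooth_lyapunov R (n + n) V0 F
  V0_ge0 (weighted_sup_lt_open bKL D_ge0 D_cont D_le)
  (fun k c _ => @weighted_sup_gt_open _ _ _ _ bKL D_ge0 D_cont D_le k c)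
  (weighted_sup_noninc bKL D_ge0 D_step D_le)
  (weighted_sup_decay bKL D_ge0 D_step D_le).
pose s (kz : int * E) := D kz.1 kz.2 0%N.
have s0 kz : 0 <= s kz by exact: D_ge0.
have [a1 a1K a1W] : exists2 al : R -> R, class_Kinf al &
    forall kz, al (s kz) <= W kz.1 kz.2.
  apply: Kinf_minorant => //.
  - by move=> kz; have /andP[] := W_bnd kz.1 kz.2.
  - move=> a /W_pos[e e0 He]; exists e => // kz akz; apply: He.
    exact: le_trans (V0_ge _ _).
  - move=> M; have [B HB] := W_infty M; exists B => kz Bkz; apply: HB.
    exact: le_trans (V0_ge _ _).
have [a3 a3pd a3W] : exists2 al : R -> R, positive_definite al &
    forall kz, al (s kz) <= W kz.1 kz.2 - W (kz.1 + 1) (F kz.1 kz.2).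
  apply: pd_minorant => [kz|a B a0]; first by rewrite subr_ge0.
  have [e e0 He] := W_dec a (2 * b B 0) a0; exists e => // kz /andP[akz kzB].
  have VB : V0 kz.1 kz.2 <= 2 * b B 0.
    apply: le_trans (V0_le _ _) _; rewrite ler_pM2l//.
    by apply: (KL_le_l bKL) => //; rewrite s0.
  have := He kz.1 kz.2; rewrite (le_trans akz (V0_ge _ _)) VB => /(_ isT).
  by lra.
pose L (p : 'rV[R]_n * 'rV[R]_n) : E := row_mx p.1 p.2.
have Llin : linear L.
  move=> c u v; apply/rowP => j; rewrite !mxE.
  by case: (fintype.split j) => i; rewrite !mxE.
pose L' : {linear ('rV[R]_n * 'rV[R]_n)%type -> E} :=
  HB.pack L (GRing.isLinear.Build _ _ _ _ _ Llin).
have L'c : continuous (L' : _ -> E).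
  rewrite (_ : (L' : _ -> E) = L)//.
  move=> p; apply/cvgrPdist_le => e e0.
  have /cvgrPdist_le/(_ _ e0) n1 :
    (fun q : 'rV[R]_n * 'rV[R]_n => q.1) @ p --> p.1 by exact: cvg_fst.
  have /cvgrPdist_le/(_ _ e0) n2 :
    (fun q : 'rV[R]_n * 'rV[R]_n => q.2) @ p --> p.2 by exact: cvg_snd.
  near=> q.
  have q1 : `|p.1 - q.1| <= e by near: q; exact: n1.
  have q2 : `|p.2 - q.2| <= e by near: q; exact: n2.
  apply: rV_norm_le => [|j]; first exact: ltW.
  rewrite !mxE; case: (fintype.split j) => i.
    by have := rV_coord_le_norm (p.1 - q.1) i; rewrite !mxE => /le_trans; exact.
  by have := rV_coord_le_norm (p.2 - q.2) i; rewrite !mxE => /le_trans; exact.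
exists (fun k x1 x2 => W k (row_mx x1 x2)), a1, (fun r => 6 * b r 0 + r), a3.
split => //.
- by move=> k x1 x2; have /andP[] := W_bnd k (row_mx x1 x2).
- by move=> k m; exact: (td_comp_linear L'c (sW k m)).
- split => //; have [bc b0 bi] := bKL.1 0 (lexx 0).
  split; first split => [||r r' r0 r'0 rr'].
  + have cid : {within `[0, +oo[, continuous (id : R -> R)}.
      by apply: continuous_subspaceT => ?; exact: cvg_id.
    by move=> r; exact: (cvgD (cvgM (cvg_cst _) (bc r)) (cid r)).
  + by rewrite b0 mulr0 addr0.
  + by rewrite ltrD// ltr_pM2l// bi.
  move=> M; exists (`|M| + 1); first by rewrite addr_ge0.
  have := KL_ge0 bKL (s := `|M| + 1) (t := 0) ltac:(by rewrite addr_ge0) (lexx 0).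
  by have := ler_norm M; lra.
move=> x1 x2 k; have sE : s (k, row_mx x1 x2) = enorm (x1 - x2).
  by rewrite /s /D /= row_mxKl row_mxKr.
split.
- by have := a1W (k, row_mx x1 x2); rewrite sE.
- have /andP[_] := W_bnd k (row_mx x1 x2).
  have := V0_le k (row_mx x1 x2); rewrite -[D _ _ _]/(s (k, row_mx x1 x2)) sE.
  by have := enorm_ge0 (x1 - x2); lra.
- have := a3W (k, row_mx x1 x2); rewrite sE /F /= row_mxKl row_mxKr; lra.
Unshelve. all: by end_near. Qed.

End Converse.

(** * Majorants of class KL *)

Section ComparisonFunctions.
Variable R : realType.
Implicit Types (a g : R -> R) (s t : R).

Lemma within_continuous_norm a : {within `[0, +oo[, continuous a} ->
  continuous (fun s => a `|s|).
Proof.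
move=> /subspace_continuousP ca s.
have s0 : [set` `[0, +oo[%R] `|s| by rewrite /= in_itv/= normr_ge0.
move=> A nA.
have wA : nbhs `|s| [set r | [set` `[0, +oo[%R] r -> A (a r)].
  exact: ca _ s0 A nA.
have nB : nbhs s [set r | [set` `[0, +oo[%R] `|r| -> A (a `|r|)].
  exact: (@norm_continuous _ R s _ wA).
by apply: filterS nB => r; apply; rewrite /= in_itv/= normr_ge0.
Qed.

Lemma K_le a s t : class_K a -> 0 <= s -> s <= t -> a s <= a t.
Proof.
move=> [_ _ incr] s0; rewrite le_eqVlt => /predU1P[->//|st].
by apply/ltW/incr => //; rewrite in_itv/= andbT// (le_trans s0 (ltW st)).
Qed.

Lemma K_lt a s t : class_K a -> 0 <= s -> s < t -> a s < a t.
Proof.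
move=> [_ _ incr] s0 st; apply: incr => //; rewrite in_itv/= andbT//.
by rewrite (le_trans s0 (ltW st)).
Qed.

Lemma K_ge0 a s : class_K a -> 0 <= s -> 0 <= a s.
Proof. by move=> aK s0; have [_ <- _] := aK; exact: K_le. Qed.

Lemma Kinf_inverse a : class_Kinf a -> exists g, [/\ continuous g, g 0 = 0,
  forall s t, 0 <= s -> s < t -> g s < g t & forall s, 0 <= s -> g (a s) = s].
Proof.
move=> [aK aoo]; have [ac a0 _] := aK.
have ca := within_continuous_norm ac.
have /choice[g Hg] : forall r : R, exists s, 0 <= s /\ a s = `|r|.
  move=> r; have [M M0 rM] := aoo `|r|.
  have cM : {within `[0, M], continuous (fun s => a `|s|)}.
    exact: continuous_subspaceT.
  have rng : Num.min (a `|0 : R|) (a `|M|) <= `|r| <= Num.max (a `|0 : R|) (a `|M|).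
    by rewrite normr0 a0 (ger0_norm M0) ge_min normr_ge0/= le_max (ltW rM) orbT.
  have [s] := IVT M0 cM rng.
  rewrite in_itv/= => /andP[s0 _]; rewrite (ger0_norm s0) => as_.
  by exists s.
have g0 r : 0 <= g r by case: (Hg r).
have ag r : a (g r) = `|r| by case: (Hg r).
have g_lt r s : 0 <= s -> `|r| < a s -> g r < s.
  by move=> s0 ras; rewrite ltNge; apply/negP => /(K_le aK s0); rewrite ag; lra.
have g_gt r s : a s < `|r| -> s < g r.
  by move=> ras; rewrite ltNge; apply/negP => /(K_le aK (g0 r)); rewrite ag; lra.
have gK s : 0 <= s -> g (a s) = s.
  move=> s0; have as0 := K_ge0 aK s0.
  apply/eqP; rewrite eq_le !leNgt; apply/andP; split; apply/negP.
    by move=> /(K_lt aK s0); rewrite ag ger0_norm// ltxx.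
  by move=> /(K_lt aK (g0 _)); rewrite ag ger0_norm// ltxx.
exists g; split => //.
- move=> r; apply/cvgrPdist_le => e e0.
  have up : `|r| < a (g r + e) by rewrite -ag; apply: K_lt => //; rewrite ltrDl.
  have nup : \forall r' \near r, `|r'| < a (g r + e).
    have /cvgr_lt := @norm_continuous _ R r; exact.
  have nlo : \forall r' \near r, g r - e < g r'.
    have [re|re] := ltP (g r - e) 0.
      by near=> r'; exact: lt_le_trans re (g0 r').
    have lo : a (g r - e) < `|r| by rewrite -ag; apply: K_lt => //; rewrite gtrBl.
    have /cvgr_gt/(_ _ lo) := @norm_continuous _ R r.
    by apply: filterS => r'; exact: g_gt.
  near=> r'; rewrite ler_distlC; apply/andP; split.
    by apply/ltW; near: r'.
  have : `|r'| < a (g r + e) by near: r'.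
  by move=> /g_lt H; apply/ltW/H; rewrite addr_ge0// ltW.
- by rewrite -[X in g X]a0 gK.
- move=> s t s0 st; have t0 := le_lt_trans s0 st.
  by apply: g_lt => //; rewrite ag !ger0_norm// ltW.
Unshelve. all: by end_near. Qed.

End ComparisonFunctions.

Lemma max0_le (R : realType) (r r' c : R) : 0 <= c -> r <= r' + c ->
  Num.max 0 r <= Num.max 0 r' + c.
Proof.
move=> c0 rr'; rewrite ge_max addr_ge0 ?le_max ?lexx//=.
by apply: (le_trans rr'); rewrite lerD2r le_max lexx orbT.
Qed.

Section DecayEnvelope.
Variables (R : realType) (T : Type) (t0 : T) (y : T -> nat -> R).
Hypothesis y_ge0 : forall x j, 0 <= y x j.
Hypothesis y_le : forall x j, y x j <= y x 0%N.
Hypothesis y_attr : forall M e, 0 < e -> exists J : nat,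
  forall x j, y x 0%N <= M -> (J <= j)%N -> y x j <= e.

(* The penalty makes the envelope Lipschitz in [v]; factor 2 is what keeps the
   supremum finite: only the sequences starting below [2 v] contribute. *)
Definition cutoff (v : R) (x : T) j : R :=
  Num.max 0 (y x j - 2 * Num.max 0 (y x 0%N - v)).

Definition ramp (t : R) (j : nat) : R := Num.max 0 (Num.min 1 (1 + j%:R - t)).

Definition envelope (v t : R) : R :=
  sup (range (fun xj : T * nat => cutoff v xj.1 xj.2 * ramp t xj.2)).

Lemma ramp_ge0 t j : 0 <= ramp t j.
Proof. by rewrite le_max lexx. Qed.

Lemma ramp_le1 t j : ramp t j <= 1.
Proof. by rewrite ge_max ler01 ge_min lexx. Qed.

Lemma cutoff_ge0 v x j : 0 <= cutoff v x j.
Proof. by rewrite le_max lexx. Qed.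

Lemma cutoff_le v x j : cutoff v x j <= `|v|.
Proof.
rewrite ge_max normr_ge0/=; have := ler_norm v; have := normr_ge0 v.
by have := y_le x j; have := y_ge0 x 0; case: (leP 0 (y x 0%N - v)); lra.
Qed.

Lemma envelope_ge v t x j : cutoff v x j * ramp t j <= envelope v t.
Proof.
apply: ub_le_sup; last by exists (x, j).
exists `|v| => _ [[x' j'] _ <-] /=.
rewrite -[leRHS]mulr1; apply: ler_pM; rewrite ?cutoff_ge0 ?ramp_ge0 ?cutoff_le//.
exact: ramp_le1.
Qed.

Lemma envelope_le v t c : (forall x j, cutoff v x j * ramp t j <= c) ->
  envelope v t <= c.
Proof.
move=> H; apply: ge_sup; first by exists (cutoff v t0 0 * ramp t 0), (t0, 0%N).
by move=> _ [[x j] _ <-]; exact: H.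
Qed.

Lemma envelope_ge0 v t : 0 <= envelope v t.
Proof.
by apply: le_trans (envelope_ge v t t0 0); rewrite mulr_ge0 ?cutoff_ge0 ?ramp_ge0.
Qed.

Lemma envelope_0 t : envelope 0 t = 0.
Proof.
apply/eqP; rewrite eq_le envelope_ge0 andbT; apply: envelope_le => x j.
rewrite (_ : cutoff 0 x j = 0) ?mul0r//; apply/eqP.
by rewrite eq_le cutoff_ge0 andbT -[leRHS](normr0 R) cutoff_le.
Qed.

Lemma envelope_le_l v v' t : v <= v' -> envelope v t <= envelope v' t.
Proof.
move=> vv'; apply: envelope_le => x j; apply: le_trans (envelope_ge v' t x j).
rewrite ler_wpM2r ?ramp_ge0// ge_max cutoff_ge0/= le_max; apply/orP; right.
by case: (leP 0 (y x 0%N - v)); case: (leP 0 (y x 0%N - v')); lra.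
Qed.

Lemma envelope_le_r v t t' : t <= t' -> envelope v t' <= envelope v t.
Proof.
move=> tt'; apply: envelope_le => x j; apply: le_trans (envelope_ge v t x j).
rewrite ler_wpM2l ?cutoff_ge0// ge_max ramp_ge0/= le_max; apply/orP; right.
by case: (leP 1 (1 + j%:R - t)); case: (leP 1 (1 + j%:R - t')); lra.
Qed.

Lemma envelope_continuous_l t : continuous (fun v => envelope v t).
Proof.
apply: (@lipschitz_continuous _ _ 2) => v v'; apply: envelope_le => x j.
have d0 := normr_ge0 (v - v').
have cv : cutoff v x j <= cutoff v' x j + 2 * `|v - v'|.
  apply: max0_le; first by rewrite mulr_ge0.
  have : Num.max 0 (y x 0%N - v') <= Num.max 0 (y x 0%N - v) + `|v - v'|.
    by apply: max0_le => //; have := ler_norm (v - v'); lra.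
  set A := Num.max _ _; set A' := Num.max _ _; lra.
apply: (@le_trans _ _ ((cutoff v' x j + 2 * `|v - v'|) * ramp t j)).
  by rewrite ler_wpM2r ?ramp_ge0.
by rewrite mulrDl lerD ?envelope_ge// ler_piMr ?ramp_le1// mulr_ge0.
Qed.

Lemma envelope_continuous_r v : continuous (envelope v).
Proof.
apply: (@lipschitz_continuous _ _ `|v|) => t t'; apply: envelope_le => x j.
have d0 := normr_ge0 (t - t').
have rt : ramp t j <= ramp t' j + `|t - t'|.
  apply: max0_le => //; rewrite -lerBlDr le_min !lerBlDr !ge_min lerDl d0/=.
  have := ler_norm (- (t - t')); rewrite normrN => H.
  by apply/orP; right; lra.
apply: (@le_trans _ _ (cutoff v x j * (ramp t' j + `|t - t'|))).
  by rewrite ler_wpM2l ?cutoff_ge0.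
by rewrite mulrDr lerD ?envelope_ge// ler_wpM2r ?cutoff_le.
Qed.

Lemma envelope_small v e : 0 < e ->
  exists M, forall t, M <= t -> envelope v t <= e.
Proof.
move=> e0; have [J HJ] := y_attr (2 * v) e0.
exists (J%:R + 1) => t Jt; apply: envelope_le => x j.
have [jJ|Jj] := ltnP j J.
  rewrite (_ : ramp t j = 0) ?mulr0 ?ltW//; apply/max_idPl; rewrite ge_min.
  have jJR : j%:R + 1 <= J%:R :> R by rewrite natr1 ler_nat.
  by apply/orP; right; lra.
have [y2|y2] := leP (y x 0%N) (2 * v).
  apply: (@le_trans _ _ (cutoff v x j)).
    by rewrite ler_piMr ?ramp_le1 ?cutoff_ge0.
  rewrite ge_max (ltW e0)/=; apply: le_trans (HJ x j y2 Jj).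
  by rewrite gerBl mulr_ge0// le_max lexx.
rewrite (_ : cutoff v x j = 0) ?mul0r ?ltW//; apply/max_idPl.
by have := y_le x j; have := y_ge0 x j; case: (leP 0 (y x 0%N - v)); lra.
Qed.

Lemma envelope_ge_seq x j : y x j <= envelope (y x 0%N) j%:R.
Proof.
apply: le_trans (envelope_ge _ _ x j).
rewrite /cutoff subrr maxxx mulr0 subr0 /ramp addrK minxx.
by rewrite (_ : Num.max 0 1 = 1) ?mulr1 ?le_max ?lexx ?orbT//; apply/max_idPr.
Qed.

End DecayEnvelope.

(** * From Lyapunov functions to stability *)

Section Direct.
Variables (R : realType) (n : nat) (f : int -> 'rV[R]_n -> 'rV[R]_n).
Variables (V : int -> 'rV[R]_n -> 'rV[R]_n -> R) (a1 a2 a3 : R -> R).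
Hypothesis V_ge0 : forall k x1 x2, 0 <= V k x1 x2.
Hypothesis a1K : class_Kinf a1.
Hypothesis a2K : class_Kinf a2.
Hypothesis a3pd : positive_definite a3.
Hypothesis V_ge : forall k x1 x2, a1 (enorm (x1 - x2)) <= V k x1 x2.
Hypothesis V_le : forall k x1 x2, V k x1 x2 <= a2 (enorm (x1 - x2)).
Hypothesis V_dec : forall k x1 x2,
  V (k + 1) (f k x1) (f k x2) <= V k x1 x2 - a3 (enorm (x1 - x2)).

Local Notation start := (int * 'rV[R]_n * 'rV[R]_n)%type.
Implicit Type x : start.

Let dist x j := enorm (phi_steps f x.1.1 x.1.2 j - phi_steps f x.1.1 x.2 j).
Let val x j :=
  V (x.1.1 + j%:Z) (phi_steps f x.1.1 x.1.2 j) (phi_steps f x.1.1 x.2 j).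

Let val_step x j : val x j.+1 <= val x j - a3 (dist x j).
Proof.
rewrite /val (_ : x.1.1 + j.+1%:Z = x.1.1 + j%:Z + 1); first exact: V_dec.
by rewrite -addrA -PoszD addn1.
Qed.

Let a3_ge0 s : 0 <= s -> 0 <= a3 s.
Proof.
have [_ a30 a3p] := a3pd; rewrite le_eqVlt => /predU1P[<-|/a3p/ltW//].
by rewrite a30.
Qed.

Let val_succ x j : val x j.+1 <= val x j.
Proof. by apply: (le_trans (val_step x j)); rewrite gerBl a3_ge0// enorm_ge0. Qed.

Let val_le x j : val x j <= val x 0%N.
Proof. by elim: j => // j; apply: le_trans; exact: val_succ. Qed.

Lemma val_decrease M e : 0 < e -> exists2 mu, 0 < mu &
  forall x j, e <= val x j <= M -> val x j.+1 <= val x j - mu.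
Proof.
move=> e0; have [[a1K' a1oo] [a2K' _]] := (a1K, a2K).
have [s2 s20 Ms2] := a1oo M.
have [s1 s10 s1e] : exists2 s1, 0 < s1 & a2 s1 < e.
  have [a2c a20 _] := a2K'.
  have c0 := within_continuous_norm a2c (x := 0).
  have : \forall r \near (0 : R), a2 `|r| < e.
    by move/cvgr_lt: c0; apply; rewrite normr0 a20.
  move=> /nbhs_ballP[d /= d0 Hd]; exists (d / 2); first by rewrite divr_gt0.
  rewrite -[X in a2 X]gtr0_norm ?divr_gt0//; apply: Hd.
  rewrite -ball_normE /= sub0r normrN gtr0_norm ?divr_gt0//; lra.
have [a3c a30 a3p] := a3pd.
have [s12|s21] := leP s1 s2; last first.
  exists 1 => // x j /andP[ev vM]; exfalso.
  have d1 : s1 < dist x j.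
    rewrite ltNge; apply/negP => /(K_le a2K' (enorm_ge0 _)).
    by have := V_le (x.1.1 + j%:Z) (phi_steps f x.1.1 x.1.2 j)
      (phi_steps f x.1.1 x.2 j); rewrite -/(val x j) -/(dist x j); lra.
  have := K_le a1K' s20 (ltW (lt_trans s21 d1)).
  by have := V_ge (x.1.1 + j%:Z) (phi_steps f x.1.1 x.1.2 j)
    (phi_steps f x.1.1 x.2 j); rewrite -/(val x j) -/(dist x j); lra.
have a3c' : {within `[s1, s2], continuous (fun s => a3 `|s|)}.
  by apply: continuous_subspaceT; exact: within_continuous_norm.
have [c c12 Hc] := EVT_min s12 a3c'.
have c0 : 0 < c by move: c12; rewrite in_itv/= => /andP[+ _]; exact: lt_le_trans.
exists (a3 c); first exact: a3p.
move=> x j /andP[ev vM]; apply: (le_trans (val_step x j)); rewrite lerD2l lerN2.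
have d0 : 0 <= dist x j by exact: enorm_ge0.
have := Hc (dist x j); rewrite (ger0_norm d0) (gtr0_norm c0); apply.
have := V_le (x.1.1 + j%:Z) (phi_steps f x.1.1 x.1.2 j) (phi_steps f x.1.1 x.2 j).
have := V_ge (x.1.1 + j%:Z) (phi_steps f x.1.1 x.1.2 j) (phi_steps f x.1.1 x.2 j).
rewrite -/(val x j) -/(dist x j) => v1 v2.
rewrite in_itv/= !leNgt; apply/andP; split; apply/negP => /ltW.
  by move=> /(K_le a2K' d0); lra.
by move=> /(K_le a1K' s20); lra.
Qed.

Lemma val_attractive M e : 0 < e -> exists J : nat,
  forall x j, val x 0%N <= M -> (J <= j)%N -> val x j <= e.
Proof.
move=> e0; have [mu mu0 Hmu] := val_decrease M e0.
exists (Num.truncn (M / mu)).+1 => x j xM Jj.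
have : val x j <= Num.max e (M - j%:R * mu).
  elim: j {Jj} => [|j IHj]; first by rewrite mul0r subr0 le_max xM orbT.
  have [ve|/ltW ev] := leP (val x j) e.
    by rewrite le_max (le_trans (val_succ x j)).
  have := Hmu x j; rewrite ev (le_trans (val_le x j) xM) => /(_ isT) vmu.
  move: IHj; rewrite !le_max => /orP[vj|vj]; apply/orP.
    by left; rewrite (le_trans (val_succ x j)).
  by right; rewrite -natr1 mulrDl mul1r; lra.
move=> /le_trans; apply; rewrite ge_max lexx/= lerBlDr.
apply: (@le_trans _ _ (j%:R * mu)); last by rewrite lerDr ltW.
rewrite -ler_pdivrMr//; apply/ltW/(lt_le_trans (truncnS_gt _)).
by rewrite ler_nat.
Qed.

Lemma lyapunov_stable : incrementally_stable f.
Proof.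
have [g [gc g0 g_lt gK]] := Kinf_inverse a1K.
have [[a1K' _] [a2K' _]] := (a1K, a2K); have [a2c a20 _] := a2K'.
have ca2 := within_continuous_norm a2c.
have x0 : start := (0, 0, 0).
have val0 x j : 0 <= val x j by exact: V_ge0.
pose B := envelope val.
pose inner (s t : R) : R := B (a2 `|s|) t + a2 `|s| * expR (- t).
have B_ge0 (v t : R) : 0 <= B v t by exact: (envelope_ge0 x0 val0 val_le).
have a2_ge0 (s : R) : 0 <= a2 `|s| by exact: K_ge0.
have inner_ge0 (s t : R) : 0 <= inner s t.
  by rewrite addr_ge0 ?B_ge0// mulr_ge0// expR_ge0.
have inner_cl (t : R) : continuous (inner^~ t).
  move=> s; apply: cvgD.
    apply: (@continuous_comp _ _ _ (fun s => a2 `|s|) (fun v => B v t)).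
      exact: ca2.
    exact: (envelope_continuous_l x0 val0 val_le).
  by apply: cvgM; [exact: ca2|exact: cvg_cst].
have inner_cr (s : R) : continuous (inner s).
  move=> t; apply: cvgD; first exact: (envelope_continuous_r x0 val0 val_le).
  apply: cvgM; first exact: cvg_cst.
  apply: (@continuous_comp _ _ _ (fun t : R => - t) expR); first exact: opp_continuous.
  exact: continuous_expR.
have inner_ltl (t s s' : R) : 0 <= s -> s < s' -> inner s t < inner s' t.
  move=> s0 ss'; have aa := K_lt a2K' s0 ss'.
  have s'0 : 0 <= s' by exact: ltW (le_lt_trans s0 ss').
  rewrite /inner !ger0_norm// ler_ltD//.
    by apply: (envelope_le_l x0 val0 val_le); exact: ltW.
  by rewrite ltr_pM2r ?expR_gt0.
have inner_ltr (s t t' : R) : 0 < s -> t < t' -> inner s t' < inner s t.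
  move=> s0 tt'; rewrite /inner ler_ltD//.
    by apply: (envelope_le_r x0 val0 val_le); exact: ltW.
  rewrite ltr_pM2l ?ltr_expR ?ltrN2// -[ltLHS]a20 gtr0_norm//.
  exact: K_lt.
have inner_0 (s : R) : inner s t @[t --> +oo] --> (0 : R).
  rewrite -[X in _ --> X]addr0; apply: cvgD.
    apply/cvgrPdist_le => e e0.
    have [M HM] := envelope_small x0 val0 val_le val_attractive (a2 `|s|) e0.
    near=> t; rewrite sub0r normrN ger0_norm ?B_ge0//; apply: HM.
    by near: t; apply: nbhs_pinfty_ge; exact: num_real.
  rewrite -(mulr0 (a2 `|s|)).
  exact: (cvgM (cvg_cst _) (@cvgr_expR R)).
exists (fun s t => g (inner s t)); split; first split => [t t0|s s0].
- split => [||s s'].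
  + apply: continuous_subspaceT => s.
    exact: (continuous_comp (@inner_cl t s) (gc _)).
  + rewrite /inner normr0 a20 mul0r addr0.
    by rewrite /B (envelope_0 x0 val0 val_le).
  + rewrite !in_itv/= !andbT => s0 _ ss'.
    by apply: g_lt => //; exact: inner_ltl.
- split => [|t t'|].
  + apply: continuous_subspaceT => t.
    exact: (continuous_comp (@inner_cr s t) (gc _)).
  + by move=> _ _ tt'; apply: g_lt => //; exact: inner_ltr.
  + have := @cvg_comp _ _ _ (inner s) g _ _ _ (inner_0 s) (gc 0).
    by rewrite g0.
move=> xi1 xi2 k k0 k0k.
pose j := `|k - k0|%N.
have jE : k - k0 = j%:Z by rewrite /j gez0_abs// subr_ge0.
pose x : start := (k0, xi1, xi2).
have dj : 0 <= dist x j by exact: enorm_ge0.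
rewrite /phi -/j -[enorm _]/(dist x j) jE -(gK _ dj).
suff : a1 (dist x j) <= inner (enorm (xi1 - xi2)) j%:R.
  rewrite le_eqVlt => /predU1P[->//|lt1].
  by apply/ltW/g_lt => //; exact: K_ge0.
apply: le_trans (V_ge _ _ _) _; rewrite -/(val x j).
apply: (le_trans (envelope_ge_seq val0 val_le x j)).
apply: (@le_trans _ _ (B (a2 `|enorm (xi1 - xi2)|) j%:R)).
  apply: (envelope_le_l x0 val0 val_le); rewrite ger0_norm ?enorm_ge0//.
  by rewrite /val /= addr0; exact: V_le.
by rewrite lerDl mulr_ge0// expR_ge0.
Unshelve. all: by end_near. Qed.

End Direct.

Theorem theorem9 (R : realType) (n : nat) (f : int -> 'rV[R]_n -> 'rV[R]_n)
    (f_cont : continuous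
       (fun p : discrete_topology int * 'rV[R]_n => f p.1 p.2)) :
  incrementally_stable f <->
  exists (V : int -> 'rV[R]_n -> 'rV[R]_n -> R) (a1 a2 a3 : R -> R),
    [/\ forall k x1 x2, 0 <= V k x1 x2,
        forall k, smooth (fun p : 'rV[R]_n * 'rV[R]_n => V k p.1 p.2),
        class_Kinf a1 /\ class_Kinf a2,
        positive_definite a3 &
        forall (x1 x2 : 'rV[R]_n) (k : int),
          [/\ a1 (enorm (x1 - x2)) <= V k x1 x2,
              V k x1 x2 <= a2 (enorm (x1 - x2)) &
              V (k + 1) (f k x1) (f k x2) - V k x1 x2
                <= - a3 (enorm (x1 - x2))]].
Proof.
split.
  apply: stable_lyapunov => k x.
  have pair_cont : {for x, continuous
      (fun y => (k, y) : discrete_topology int * 'rV[R]_n)}.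
    move=> A [[P Q] /= [Pk Qx] PQA]; apply: filterS Qx => y Qy.
    by apply: PQA; split => //=; exact: nbhs_singleton Pk.
  exact: (continuous_comp pair_cont (f_cont (k, x))).
move=> [V [a1 [a2 [a3 [V0 _ [a1K a2K] a3pd VE]]]]].
have V_ge k x1 x2 : a1 (enorm (x1 - x2)) <= V k x1 x2 by case: (VE x1 x2 k).
have V_le k x1 x2 : V k x1 x2 <= a2 (enorm (x1 - x2)) by case: (VE x1 x2 k).
have V_dec k x1 x2 :
    V (k + 1) (f k x1) (f k x2) <= V k x1 x2 - a3 (enorm (x1 - x2)).
  by have [_ _] := VE x1 x2 k; lra.
exact: lyapunov_stable V0 a1K a2K a3pd V_ge V_le V_dec.
Qed.
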